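(* Let $R$ be a real closed field and let $\tilde R$ be its continuous closure. Then the spaces of $\mathbb R$-places $M(R(X))$ and $M(\tilde R(X))$ of the rational function fields $R(X)$ and $\tilde R(X)$ are homeomorphic.
   Context: An order $P$ of a field $K$ is identified with its set of positive elements. For an order $P$ of $K$ put $A(P)=\{a\in K:\exists q\in\mathbb Q^+,\ q\pm a\in P\}$, a valuation ring of $K$ with maximal ideal $I(P)=\{a\in K:\forall q\in\mathbb Q^+,\ q\pm a\in P\}$. The residue field $k(P)=A(P)/I(P)$ inherits an Archimedean order from $P$, so it embeds uniquely as an ordered field in $\mathbb R$. The $\mathbb R$-place $\lambda_K(P):K\to\mathbb R\cup\{\infty\}$ sends $a\in A(P)$ to its residue class viewed in $\mathbb R$, and $a\notin A(P)$ to $\infty$. $\mathcal X(K)$ is the set of all orders of $K$, with the topology having as subbase the Harrison sets $H_K(a)=\{P\in\mathcal X(K): a\in P\}$, $a\in K\setminus\{0\}$. $M(K)$ is the set of all $\mathbb R$-places of $K$, with the quotient topology from the surjection $\lambda_K:\mathcal X(K)\to M(K)$. A cut in an ordered field $K$ is a pair $(A,B)$ with $A\cup B=K$ and $a<b$ for all $a\in A$, $b\in B$; $A$ or $B$ may be empty. A cut is normal if for every $c>0$ in $K$ there are $a\in A$, $b\in B$ with $b-a<c$. A cut is principal if $A$ has a maximal element or $B$ has a minimal element. An ordered field is continuous closed if every normal cut in it is principal. A continuous closure of an ordered field $K$ is an ordered extension field $\tilde K\supseteq K$ that is continuous closed and in which $K$ is dense (with respect to the order). It is known that the continuous closure is uniquely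 determined by $K$, and is real closed if $K$ is real closed. *)

(* Defs.v *)
From HB Require Import structures.
From mathcomp Require Import all_boot all_order all_algebra generic_quotient ring_quotient fraction.
From mathcomp Require Import lra ring.
From mathcomp Require Import boolp classical_sets functions reals topology.

Set Implicit Arguments.
Unset Strict Implicit.
Unset Printing Implicit Defensive.
Import Order.TTheory GRing.Theory Num.Theory.
Local Open Scope classical_set_scope.
Local Open Scope ring_scope.
Local Open Scope quotient_scope.

(* An order is given by its strictly positive elements. *)
Definition is_order (K : fieldType) (P : set K) : Prop :=
  [/\ ~ P 0,
      forall a b, P a -> P b -> P (a + b),
      forall a b, P a -> P b -> P (a * b) &
      forall a, a != 0 -> P a \/ P (- a)].

Record field_order (K : fieldType) := FieldOrder {
  positive : set K;
  posP : is_order positive }.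

HB.instance Definition _ (K : fieldType) := gen_eqMixin (field_order K).
HB.instance Definition _ (K : fieldType) := gen_choiceMixin (field_order K).

Definition Harrison (K : fieldType) (a : K) : set (field_order K) :=
  [set P | positive P a].

HB.instance Definition _ (K : fieldType) := @isSubBaseTopological.Build
  (field_order K) (set (field_order K)) [set H | exists2 a, a != 0 & H = Harrison a] id.

(* K as a realFieldType, ordered by P; used only in proofs. *)
Definition ordered (K : fieldType) (P : field_order K) : Type := K.

Section Ordered.
Variables (K : fieldType) (P : field_order K).
HB.instance Definition _ := GRing.Field.on (ordered P).

Let F := ordered P.
Let lt (x y : F) : bool := `[< positive P (y - x) >].
Let le (x y : F) : bool := (x == y) || lt x y.
Let norm (x : F) : F := if le 0 x then x else - x.

Let P0 : ~ positive P 0. Proof. by case: (posP P). Qed.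
Let PD a b : positive P a -> positive P b -> positive P (a + b).
Proof. by case: (posP P) => _ h _ _; exact: h. Qed.
Let PM a b : positive P a -> positive P b -> positive P (a * b).
Proof. by case: (posP P) => _ _ h _; exact: h. Qed.
Let PN a : positive P a -> ~ positive P (- a).
Proof. by move=> h1 h2; apply: P0; rewrite -(addrN a); exact: PD. Qed.
Let PV a : a != 0 -> positive P a \/ positive P (- a).
Proof. by case: (posP P) => _ _ _; apply. Qed.

Let ltD (x y : F) : lt 0 x -> lt 0 y -> lt 0 (x + y).
Proof. by rewrite /lt !subr0 => /asboolP hx /asboolP hy; apply/asboolP/PD. Qed.
Let ltM (x y : F) : lt 0 x -> lt 0 y -> lt 0 (x * y).
Proof. by rewrite /lt !subr0 => /asboolP hx /asboolP hy; apply/asboolP/PM. Qed.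
Let lt_gt (x : F) : lt 0 x -> ~~ lt x 0.
Proof. by rewrite /lt subr0 sub0r => /asboolP hx; apply/asboolPn/PN. Qed.
Let subr_gt0' (x y : F) : lt 0 (y - x) = lt x y.
Proof. by rewrite /lt subr0. Qed.
Let lt_total (x : F) : x != 0 -> lt 0 x || lt x 0.
Proof.
by rewrite /lt subr0 sub0r => /PV[h|h]; apply/orP; [left|right]; apply/asboolP.
Qed.
Let normN (x : F) : norm (- x) = norm x.
Proof.
rewrite /norm /le [0 == - x]eq_sym oppr_eq0 [0 == x]eq_sym.
have [->|x0] /= := eqVneq x 0; first by rewrite oppr0.
rewrite /lt !subr0; case: asboolP => h1; case: asboolP => h2 //.
- by case: (PN h2).
- by rewrite opprK.
- by case: (PV x0).
Qed.
Let ge0_norm (x : F) : le 0 x -> norm x = x.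
Proof. by rewrite /norm => ->. Qed.
Let le_def (x y : F) : le x y = (x == y) || lt x y.
Proof. by []. Qed.

HB.instance Definition _ := Num.IntegralDomain_isLtReal.Build (ordered P)
  ltD ltM lt_gt subr_gt0' lt_total normN ge0_norm le_def.

Lemma pos_gt0 (x : ordered P) : positive P x <-> 0 < x.
Proof. by rewrite /Order.lt /= /lt subr0; split=> /asboolP. Qed.
End Ordered.

(* The real number determined by the rational cut of a finite element. *)
Section StandardPart.
Variables (F : realFieldType) (RR : realType).

Definition finite_elt (a : F) := exists2 q : rat, 0 < q & `|a| < ratr q.

Definition stdpart (a : F) : RR := sup [set ratr q | q in [set q : rat | ratr q < a]].

Lemma stdpart_bounds (a : F) : finite_elt a ->
  (forall q : rat, ratr q < a -> ratr q <= stdpart a) /\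
  (forall q : rat, a < ratr q -> stdpart a <= ratr q).
Proof.
case=> M M0; rewrite ltr_norml => /andP[Ma aM].
have ub q : a < ratr q ->
    ubound [set (ratr q : RR) | q in [set q : rat | ratr q < a]] (ratr q).
  move=> aq _ [r /= ra <-]; rewrite ler_rat ltW//.
  by rewrite -(@ltr_rat F); exact: lt_trans aq.
have ne : [set (ratr q : RR) | q in [set q : rat | ratr q < a]] !=set0.
  by exists (ratr (- M)), (- M) => //=; rewrite rmorphN.
split=> q qa; last exact: (ge_sup ne (ub _ qa)).
by apply: ub_le_sup; [exists (ratr M); exact: ub|exists q].
Qed.

Lemma stdpart_near (a : F) (q e : rat) : finite_elt a ->
  `|stdpart a - ratr q| < ratr e -> `|a - ratr q| <= ratr e.
Proof.
move=> /stdpart_bounds[lo hi]; rewrite ltr_norml ler_norml => /andP[h1 h2].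
apply/andP; split; rewrite leNgt; apply/negP => h.
  have /hi : a < ratr (q - e) by rewrite rmorphB /=; lra.
  by rewrite rmorphB /=; lra.
have /lo : ratr (q + e) < a by rewrite rmorphD /=; lra.
by rewrite rmorphD /=; lra.
Qed.

Lemma near_stdpart (a : F) (q e : rat) : finite_elt a ->
  `|a - ratr q| < ratr e -> `|stdpart a - ratr q| <= ratr e.
Proof.
move=> /stdpart_bounds[lo hi]; rewrite ltr_norml ler_norml => /andP[h1 h2].
have /lo : ratr (q - e) < a by rewrite rmorphB /=; lra.
have /hi : a < ratr (q + e) by rewrite rmorphD /=; lra.
by rewrite rmorphD rmorphB /=; lra.
Qed.

Lemma stdpart_uniq (a : F) (r : RR) : finite_elt a ->
  (forall q : rat, ratr q < a -> ratr q <= r) ->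
  (forall q : rat, a < ratr q -> r <= ratr q) -> r = stdpart a.
Proof.
move=> fa lo hi; have [lo' hi'] := stdpart_bounds fa.
have key (x y : RR) : (forall q : rat, ratr q < a -> ratr q <= x) ->
    (forall q : rat, a < ratr q -> y <= ratr q) -> y <= x.
  move=> lox hiy; rewrite leNgt; apply/negP => xy.
  have [q] := rat_in_itvoo xy; rewrite in_itv/= => /andP[xq qy].
  have [q'] := rat_in_itvoo qy; rewrite in_itv/= => /andP[qq' q'y].
  have [h|h] := leP a (ratr q).
    have /hiy : a < ratr q'.
      by apply: le_lt_trans h _; rewrite ltr_rat; rewrite ltr_rat in qq'.
    by rewrite leNgt q'y.
  by have := lox _ h; rewrite leNgt xq.
by apply/eqP; rewrite eq_le; apply/andP; split; apply: key.
Qed.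

Lemma stdpart_rat (q : rat) : stdpart (ratr q) = ratr q.
Proof.
apply/esym/stdpart_uniq.
- exists (`|q| + 1); first by have := normr_ge0 q; lra.
  by rewrite -ratr_norm ltr_rat; lra.
- by move=> r; rewrite ltr_rat ler_rat => /ltW.
- by move=> r; rewrite ltr_rat ler_rat => /ltW.
Qed.

Lemma finite_rat (q : rat) : finite_elt (ratr q).
Proof.
exists (`|q| + 1); first by have := normr_ge0 q; lra.
by rewrite -ratr_norm ltr_rat; lra.
Qed.

Lemma finiteN (a : F) : finite_elt a -> finite_elt (- a).
Proof. by case=> q q0 aq; exists q; rewrite ?normrN. Qed.

Lemma finiteD (a b : F) : finite_elt a -> finite_elt b -> finite_elt (a + b).
Proof.
move=> [q q0 aq] [r r0 br]; exists (q + r); first exact: addr_gt0.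
by rewrite rmorphD /=; apply: le_lt_trans (ler_normD _ _) _; lra.
Qed.

Lemma finiteM (a b : F) : finite_elt a -> finite_elt b -> finite_elt (a * b).
Proof.
move=> [q q0 aq] [r r0 br]; exists (q * r); first exact: mulr_gt0.
by rewrite rmorphM /= normrM; apply: ltr_pM.
Qed.

Lemma stdpart_approx (a : F) (e : rat) : finite_elt a -> 0 < e ->
  exists q : rat, `|stdpart a - ratr q| < ratr e /\ `|a - ratr q| <= ratr e.
Proof.
move=> fa e0; have e0R : (0 : RR) < ratr e by rewrite ltr0q.
have xy : stdpart a - ratr e < stdpart a + ratr e by lra.
have [q] := rat_in_itvoo xy; rewrite in_itv/= => /andP[h1 h2].
have h : `|stdpart a - ratr q| < ratr e by rewrite ltr_norml; apply/andP; lra.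
by exists q; split=> //; exact: stdpart_near.
Qed.

Lemma rat_small_eq (x y : RR) (C : rat) : 0 < C ->
  (forall e : rat, 0 < e -> e < 1 -> `|x - y| <= ratr (C * e)) -> x = y.
Proof.
move=> C0 h; apply/eqP; rewrite -subr_eq0 -normr_le0 leNgt; apply/negP => xy.
have C0R : (0 : RR) < ratr C by rewrite ltr0q.
have : 0 < Num.min 1 (`|x - y| / ratr C) by rewrite lt_min ltr01 divr_gt0.
move=> /rat_in_itvoo[e]; rewrite in_itv/= lt_min => /and3P[e0 e1 eC].
have := h e; rewrite -(ltr0q RR) e0 -(ltr_rat RR) rmorph1 e1 => /(_ isT isT).
rewrite leNgt => /negP; apply.
by rewrite rmorphM /= mulrC -ltr_pdivlMr.
Qed.

Lemma stdpartD (a b : F) : finite_elt a -> finite_elt b ->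
  stdpart (a + b) = stdpart a + stdpart b.
Proof.
move=> fa fb; apply: (@rat_small_eq _ _ 5%:R) => // e e0 _.
have e0F : (0 : F) < ratr e by rewrite ltr0q.
have [q [sq aq]] := stdpart_approx fa e0.
have [r [sr br]] := stdpart_approx fb e0.
have : `|stdpart (a + b) - ratr (q + r)| <= ratr (3%:R * e).
  apply: near_stdpart; first exact: finiteD.
  rewrite rmorphD rmorphM rmorph_nat /=.
  by move: aq br; rewrite !ler_norml ltr_norml => /andP[? ?] /andP[? ?]; lra.
rewrite rmorphD !rmorphM !rmorph_nat /=.
by move: sq sr; rewrite !ler_norml !ltr_norml => /andP[? ?] /andP[? ?] /andP[? ?]; lra.
Qed.

Lemma stdpartM (a b : F) : finite_elt a -> finite_elt b ->
  stdpart (a * b) = stdpart a * stdpart b.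
Proof.
move=> fa fb; have [M M0 aM] := fa; have [N N0 bN] := fb.
have M0R : (0 : RR) < ratr M by rewrite ltr0q.
have N0R : (0 : RR) < ratr N by rewrite ltr0q.
have M0F : (0 : F) < ratr M by rewrite ltr0q.
have N0F : (0 : F) < ratr N by rewrite ltr0q.
apply: (@rat_small_eq _ _ (M *+ 2 + N *+ 2 + 3%:R)); first by lra.
move=> e e0 e1.
have e0F : (0 : F) < ratr e by rewrite ltr0q.
have e0R : (0 : RR) < ratr e by rewrite ltr0q.
have e1F : (ratr e : F) < 1 by rewrite -(rmorph1 (@ratr F)) ltr_rat.
have e1R : (ratr e : RR) < 1 by rewrite -(rmorph1 (@ratr RR)) ltr_rat.
have [q [sq aq]] := stdpart_approx fa e0.
have [r [sr br]] := stdpart_approx fb e0.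
have saM : `|stdpart a| <= ratr M.
  have := @near_stdpart a 0 M fa; rewrite !rmorph0 !subr0; exact.
have E (S : realFieldType) (x y p s u v d : S) : `|x| <= u -> `|y| <= v ->
    0 < d -> d < 1 -> `|x - p| <= d -> `|y - s| <= d ->
    `|x * y - p * s| <= (u + v + 1) * d.
  move=> xu yv d0 d1 xp ys.
  have -> : x * y - p * s = x * (y - s) + (x - p) * y - (x - p) * (y - s).
    by ring.
  apply: le_trans (ler_normB _ _) _; apply: le_trans (lerD (ler_normD _ _) (lexx _)) _.
  rewrite !normrM.
  have h1 : `|x| * `|y - s| <= u * d by apply: ler_pM.
  have h2 : `|x - p| * `|y| <= d * v by apply: ler_pM.
  have h3 : `|x - p| * `|y - s| <= d * 1.
    by apply: ler_pM => //; apply: le_trans ys _; exact: ltW.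
  lra.
have sbN : `|stdpart b| <= ratr N.
  have := @near_stdpart b 0 N fb; rewrite !rmorph0 !subr0; exact.
have h1 := E _ _ _ _ _ _ _ _ (ltW aM) (ltW bN) e0F e1F aq br.
have h2 := E _ _ _ _ _ _ _ _ saM sbN e0R e1R (ltW sq) (ltW sr).
have : `|stdpart (a * b) - ratr (q * r)| <= ratr ((M + N + 2%:R) * e).
  apply: near_stdpart; first exact: finiteM.
  rewrite !rmorphM !rmorphD rmorph1 /=.
  by apply: le_lt_trans h1 _; lra.
rewrite !rmorphM !rmorphD !rmorph1 /=.
by move: h2; rewrite !ler_norml => /andP[? ?] /andP[? ?]; lra.
Qed.

Lemma stdpart_gt0 (a : F) : finite_elt a ->
  (exists2 q : rat, 0 < q & ratr q < a) -> 0 < stdpart a.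
Proof.
move=> fa [q q0 /(proj1 (stdpart_bounds fa))]; apply: lt_le_trans.
by rewrite ltr0q.
Qed.

Lemma stdpart_eq0 (a : F) : (forall q : rat, 0 < q -> `|a| < ratr q) ->
  stdpart a = 0.
Proof.
move=> h; apply/esym/stdpart_uniq.
- by exists 1; rewrite // h.
- move=> q qa; rewrite lerq0 leNgt; apply/negP => /h.
  by rewrite ltNge ltW// (lt_le_trans qa)// ler_norm.
- move=> q aq; rewrite ler0q leNgt; apply/negP => q0.
  have /h : 0 < - q by rewrite oppr_gt0.
  by rewrite rmorphN ltr_norml opprK => /andP[qa _]; rewrite ltNge ltW in aq.
Qed.

End StandardPart.

Section ResidueField.

Variable K : fieldType.

Definition valuation_ring (P : field_order K) : set K :=
  [set a | exists q : rat, [/\ 0 < q, positive P (ratr q + a) & positive P (ratr q - a)]].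

Definition valuation_ideal (P : field_order K) : set K :=
  [set a | forall q : rat, 0 < q -> positive P (ratr q + a) /\ positive P (ratr q - a)].

Lemma ratr_pos_norm (P : field_order K) (a : ordered P) (q : rat) :
  positive P (ratr q + a) /\ positive P (ratr q - a) <-> `|a| < ratr q.
Proof.
rewrite ltr_norml; split=> [[/pos_gt0 h1 /pos_gt0 h2]|/andP[h1 h2]].
  by rewrite -subr_gt0 opprK addrC h1 -subr_gt0.
by split; apply/pos_gt0; [rewrite -ltrBlDl sub0r | rewrite subr_gt0].
Qed.

Lemma valuation_ringE (P : field_order K) (a : ordered P) :
  valuation_ring P a <-> finite_elt a.
Proof.
split=> [[q [q0 h1 h2]]|[q q0 /ratr_pos_norm[]]]; last by exists q.
by exists q => //; apply/ratr_pos_norm.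
Qed.

Lemma valuation_idealE (P : field_order K) (a : ordered P) :
  valuation_ideal P a <-> forall q : rat, 0 < q -> `|a| < ratr q.
Proof. by split=> h q /h /ratr_pos_norm. Qed.

Variable P : field_order K.

Definition valuation_ring_pred : {pred K} := [pred a | `[< valuation_ring P a >]].

Lemma valuation_ringP (a : K) :
  reflect (finite_elt (a : ordered P)) (a \in valuation_ring_pred).
Proof.
by rewrite inE; apply: (iffP (asboolP _)) => /(@valuation_ringE P a).
Qed.

Lemma valuation_ring_subring : subring_closed valuation_ring_pred.
Proof.
split=> [|a b /valuation_ringP fa /valuation_ringP fb
         |a b /valuation_ringP fa /valuation_ringP fb]; apply/valuation_ringP.
- by have := finite_rat (ordered P) 1; rewrite rmorph1.
- by apply: (@finiteD (ordered P)) => //; exact: (@finiteN (ordered P)).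
- exact: (@finiteM (ordered P)).
Qed.

HB.instance Definition _ :=
  GRing.isSubringClosed.Build K valuation_ring_pred valuation_ring_subring.

Record valuation_ring_type := ValuationRing {
  vr_val :> K;
  vr_valP : vr_val \in valuation_ring_pred }.

HB.instance Definition _ := [isSub for vr_val].
HB.instance Definition _ := [Choice of valuation_ring_type by <:].
HB.instance Definition _ :=
  [SubChoice_isSubComNzRing of valuation_ring_type by <:].

Definition valuation_ideal_pred : {pred valuation_ring_type} :=
  [pred a | `[< valuation_ideal P (val a) >]].

Lemma valuation_idealP (a : valuation_ring_type) :
  reflect (forall q : rat, 0 < q -> `|val a : ordered P| < ratr q)
          (a \in valuation_ideal_pred).
Proof.
by rewrite inE; apply: (iffP (asboolP _)) => /(@valuation_idealE P (val a)).
Qed.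

Lemma valuation_ideal_ideal : idealr_closed valuation_ideal_pred.
Proof.
split=> [||a x y].
- by apply/valuation_idealP => q q0; rewrite /= normr0 ltr0q.
- apply/valuation_idealP => /(_ 1 isT) /=.
  by rewrite rmorph1 (@normr1 (ordered P)) ltxx.
- move=> /valuation_idealP hx /valuation_idealP hy; apply/valuation_idealP => q q0.
  have /valuation_ringP[r r0 ar] := vr_valP a.
  have qr : 0 < q / 2%:R / r by rewrite !divr_gt0.
  have h1 := hy _ (divr_gt0 q0 (ltr0n _ 2)); have h2 := hx _ qr.
  apply: (le_lt_trans (@ler_normD _ (ordered P) (vr_val a * vr_val x) (vr_val y))).
  rewrite [ltRHS](_ : _ = ratr r * ratr (q / 2%:R / r) + ratr (q / 2%:R)).
    by rewrite (@normrM (ordered P)) ltrD// ltr_pM.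
  by rewrite -rmorphM -rmorphD; congr ratr; field; rewrite gt_eqF.
Qed.

HB.instance Definition _ :=
  isIdealr.Build valuation_ring_type valuation_ideal_pred valuation_ideal_ideal.

Definition residue_field := {ideal_quot valuation_ideal_pred}.

HB.instance Definition _ := GRing.ComNzRing.on residue_field.
HB.instance Definition _ := EqQuotient.on residue_field.

Definition residue (a : valuation_ring_type) : residue_field :=
  \pi_{ideal_quot valuation_ideal_pred} a.

Lemma residue0 : residue 0 = 0.
Proof. by rewrite /residue rmorph0. Qed.
Lemma residueD a b : residue (a + b) = residue a + residue b.
Proof. by rewrite /residue rmorphD. Qed.
Lemma residueB a b : residue (a - b) = residue a - residue b.
Proof. by rewrite /residue rmorphB. Qed.
Lemma residueM a b : residue (a * b) = residue a * residue b.
Proof. by rewrite /residue rmorphM. Qed.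
Lemma residue1 : residue 1 = 1.
Proof. by rewrite /residue rmorph1. Qed.

Lemma residue_eq0 a : (residue a == 0) = (a \in valuation_ideal_pred).
Proof. by rewrite -residue0 -[a in RHS]subr0 Quotient.idealrBE. Qed.

Lemma residueK (x : residue_field) : residue (repr x) = x.
Proof. exact: reprK. Qed.


Lemma valuation_idealN (a : valuation_ring_type) :
  reflect (exists2 q : rat, 0 < q & ratr q < `|val a : ordered P|)
          (a \notin valuation_ideal_pred).
Proof.
apply: (iffP idP) => [|[q q0 qa]]; last first.
  by apply/negP => /valuation_idealP /(_ q q0); rewrite ltNge ltW.
move=> aI; apply: contrapT => h; case/negP: aI; apply/valuation_idealP => q q0.
have q2 : 0 < q / 2%:R by rewrite divr_gt0.
rewrite ltNge; apply/negP => qa; apply: h; exists (q / 2%:R) => //.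
by apply: lt_le_trans qa; rewrite ltr_rat ltr_pdivrMr// mulr_natr ltrDl.
Qed.

Lemma valuation_ringV (a : valuation_ring_type) :
  a \notin valuation_ideal_pred -> (val a)^-1 \in valuation_ring_pred.
Proof.
move=> /valuation_idealN[q q0 qa]; apply/valuation_ringP.
exists (q^-1 *+ 2); first by rewrite pmulrn_lgt0 ?invr_gt0.
have q0F : (0 : ordered P) < ratr q by rewrite ltr0q.
rewrite (@normfV (ordered P)) rmorphMn fmorphV /=.
apply: (@lt_trans _ _ (ratr q)^-1); first by rewrite ltf_pV2 ?posrE// (lt_trans q0F).
by rewrite mulr2n ltrDl invr_gt0.
Qed.

Definition residue_inv (x : residue_field) : residue_field :=
  if x == 0 then 0 else residue (insubd 0 (val (repr x))^-1).

Lemma residue_mulVf (x : residue_field) : x != 0 -> residue_inv x * x = 1.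
Proof.
move=> x0; rewrite /residue_inv (negPf x0) -[X in _ * X]residueK -residueM -residue1.
congr residue; apply: val_inj => /=.
move: x0; rewrite -[x in x != 0]residueK residue_eq0 => xI.
rewrite insubdK; last exact: valuation_ringV.
rewrite mulVf//; case/valuation_idealN: xI => q q0 qx; apply/eqP => x0.
by move: qx; rewrite [val _]x0 normr0 ltNge ltW// ltr0q.
Qed.

Lemma residue_inv0 : residue_inv 0 = 0.
Proof. by rewrite /residue_inv eqxx. Qed.

HB.instance Definition _ :=
  GRing.ComNzRing_isField.Build residue_field residue_mulVf residue_inv0.

(* The order inherited from P: the nonzero classes that contain an element of P. *)
Definition residue_pos : set residue_field :=
  [set x | x != 0 /\ exists2 a, residue a = x & positive P (val a)].

Lemma residue_pos_order : is_order residue_pos.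
Proof.
split.
- by case; rewrite eqxx.
- move=> x y [+ [a ax pa]] [_ [b bx pb]]; rewrite -{x}ax -{y}bx -residueD => ha.
  split; last by exists (a + b) => //; case: (posP P) => _ h _ _; exact: h.
  move: ha; rewrite !residue_eq0 => /valuation_idealN[q q0 qa].
  apply/valuation_idealN; exists q => //; apply: (lt_le_trans qa).
  move: pa pb => /pos_gt0 pa /pos_gt0 pb.
  by rewrite !ger0_norm ?lerDl ?ltW// addr_gt0.
- move=> x y [x0 [a ax pa]] [y0 [b bx pb]].
  split; first by rewrite mulf_neq0.
  by exists (a * b); [rewrite residueM ax bx|case: (posP P) => _ _ h _; exact: h].
- move=> x; rewrite -[x]residueK; set a := repr x => a0.
  have : val a != 0.
    by apply: contra_neq a0 => va; rewrite -residue0; congr residue; exact: val_inj.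
  case: (posP P) => _ _ _ /[apply] -[pa|pa]; [left|right].
    by split=> //; exists a.
  by split; [rewrite oppr_eq0|exists (- a) => //; rewrite /residue rmorphN].
Qed.

Definition residue_order : field_order residue_field := FieldOrder residue_pos_order.

Section Embedding.
Variable RR : realType.

Definition order_embedding (f : residue_field -> RR) : Prop :=
  forall x, positive residue_order x -> 0 < f x.

Let std (a : valuation_ring_type) : RR := stdpart (F := ordered P) RR (val a).
Let st (x : residue_field) : RR := std (repr x).

Let fin (a : valuation_ring_type) : finite_elt (val a : ordered P).
Proof. exact/valuation_ringP/valP. Qed.

Let stdD a b : std (a + b) = std a + std b.
Proof. exact: (stdpartD (F := ordered P) RR (fin a) (fin b)). Qed.

Let st_residue a : st (residue a) = std a.
Proof.
have : a - repr (residue a) \in valuation_ideal_pred.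
  by rewrite -residue_eq0 residueB residueK subrr.
move/valuation_idealP => h; rewrite /st -[a in RHS](subrK (repr (residue a))).
by rewrite stdD [std (a - _)](stdpart_eq0 _ h) add0r.
Qed.

Let stB : zmod_morphism st.
Proof.
move=> x y; apply/esym/(canLR (addrK _)).
rewrite -[x]residueK -[y]residueK -residueB !st_residue -stdD.
by rewrite subrK.
Qed.

Let stM : monoid_morphism st.
Proof.
split=> [|x y].
  rewrite -residue1 st_residue /std /= -(rmorph1 (@ratr (ordered P))).
  by rewrite stdpart_rat rmorph1.
rewrite -[x]residueK -[y]residueK -residueM !st_residue.
exact: (stdpartM (F := ordered P) RR (fin _) (fin _)).
Qed.

Let st_pos : order_embedding st.
Proof.
move=> x [+ [a ax /pos_gt0 pa]]; rewrite -{x}ax => h; rewrite st_residue; apply: stdpart_gt0; first exact: fin.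
move: h; rewrite residue_eq0 => /valuation_idealN[q q0].
by rewrite gtr0_norm//; exists q.
Qed.

Lemma residue_embedding_exists :
  exists f : {rmorphism residue_field -> RR}, order_embedding f.
Proof.
pose mz := GRing.isZmodMorphism.Build residue_field RR st stB.
pose mm := GRing.isMonoidMorphism.Build residue_field RR st stM.
pose f : {rmorphism residue_field -> RR} := HB.pack st mz mm.
by exists f; exact: st_pos.
Qed.

(* The ordered field embedding of k(P) into the reals; it is unique by
   residue_embedding_unique below. *)
Definition residue_embedding : {rmorphism residue_field -> RR} :=
  projT1 (cid residue_embedding_exists).

Lemma residue_embeddingP : order_embedding residue_embedding.
Proof. exact: projT2 (cid residue_embedding_exists). Qed.

Let ratvr (q : rat) : valuation_ring_type :=
  insubd 0 (ratr q).

Let ratvrE q : val (ratvr q) = ratr q.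
Proof.
by rewrite insubdK//; apply/valuation_ringP; exact: (@finite_rat (ordered P)).
Qed.

Lemma order_embeddingE (f : {rmorphism residue_field -> RR}) :
  order_embedding f -> forall a, f (residue a) = stdpart (F := ordered P) RR (val a).
Proof.
move=> fpos a.
have fge0 b : positive P (val b) -> 0 <= f (residue b).
  move=> pb; have [->|b0] := eqVneq (residue b) 0; first by rewrite rmorph0.
  by apply/ltW/fpos; split=> //; exists b.
pose g q := f (residue (ratvr q)).
have gB : zmod_morphism g.
  move=> q r; rewrite /g -rmorphB -residueB; congr (f (residue _)).
  by apply: val_inj; rewrite ratvrE rmorphB /= !ratvrE (@rmorphB _ (ordered P)).
have gM : monoid_morphism g.
  split=> [|q r]; rewrite /g.
    rewrite (_ : ratvr 1 = 1) ?residue1 ?rmorph1//; apply: val_inj.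
    by rewrite ratvrE /= (@rmorph1 _ (ordered P)).
  rewrite -rmorphM -residueM; congr (f (residue _)).
  by apply: val_inj; rewrite ratvrE rmorphM /= !ratvrE (@rmorphM _ (ordered P)).
pose mz := GRing.isZmodMorphism.Build rat RR g gB.
pose mm := GRing.isMonoidMorphism.Build rat RR g gM.
pose g' : {rmorphism rat -> RR} := HB.pack g mz mm.
have gE q : f (residue (ratvr q)) = ratr q by exact: (fmorph_eq_rat g').
apply: stdpart_uniq => [|q qa|q qa]; first exact: fin.
  rewrite -subr_ge0 -gE -rmorphB -residueB; apply: fge0; apply/pos_gt0.
  by rewrite rmorphB /= ratvrE subr_gt0.
rewrite -subr_ge0 -gE -rmorphB -residueB; apply: fge0; apply/pos_gt0.
by rewrite rmorphB /= ratvrE subr_gt0.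
Qed.

Lemma residue_embedding_unique (f : {rmorphism residue_field -> RR}) :
  order_embedding f -> f =1 residue_embedding.
Proof.
move=> hf x; rewrite -[x]residueK (order_embeddingE hf).
by rewrite (order_embeddingE residue_embeddingP).
Qed.

(* The codomain is the reals together with a point at infinity, None. *)
Definition real_place (a : K) : option RR :=
  omap (fun b : valuation_ring_type => residue_embedding (residue b)) (insub a).

Lemma real_placeE (a : K) : real_place a =
  if a \in valuation_ring_pred then Some (stdpart (F := ordered P) RR a) else None.
Proof.
rewrite /real_place; case: insubP => [b bA ba|/negPf ->] //=.
by rewrite bA -ba (order_embeddingE residue_embeddingP).
Qed.

End Embedding.

End ResidueField.

Section PlaceSpace.
Variables (RR : realType) (K : fieldType).

(* M(K), a quotient of the space of orders by the surjection place_of_order. *)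
Record place := Place {
  place_fun :> K -> option RR;
  placeP : exists P : field_order K, real_place P RR = place_fun }.

HB.instance Definition _ := gen_eqMixin place.
HB.instance Definition _ := gen_choiceMixin place.

Definition place_of_order (P : field_order K) : place :=
  Place (ex_intro _ P erefl).

Definition order_of_place (p : place) : field_order K := projT1 (cid (placeP p)).

Lemma order_of_placeK : cancel order_of_place place_of_order.
Proof.
case=> f fP; rewrite /place_of_order /order_of_place /=; case: cid => P /= Pf.
by case: _ / Pf in fP *; congr Place; exact: Prop_irrelevance.
Qed.

HB.instance Definition _ :=
  isQuotient.Build (field_order K) place order_of_placeK.

Definition place_space := quotient_topology place.

End PlaceSpace.

Definition homeomorphic (S T : topologicalType) : Prop :=
  exists (f : S -> T) (g : T -> S),
    [/\ cancel f g, cancel g f, continuous f & continuous g].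

Section ContinuousClosure.

Definition is_cut (K : realFieldType) (A B : set K) : Prop :=
  A `|` B = setT /\ forall a b, A a -> B b -> a < b.

Definition normal_cut (K : realFieldType) (A B : set K) : Prop :=
  forall c : K, 0 < c -> exists a b, [/\ A a, B b & b - a < c].

Definition principal_cut (K : realFieldType) (A B : set K) : Prop :=
  (exists2 a, A a & forall x, A x -> x <= a) \/
  (exists2 b, B b & forall x, B x -> b <= x).

Definition continuous_closed (K : realFieldType) : Prop :=
  forall A B : set K, is_cut A B -> normal_cut A B -> principal_cut A B.

Definition continuous_closure (K L : realFieldType) (i : {rmorphism K -> L}) : Prop :=
  [/\ {homo i : x y / x < y},
      continuous_closed L &
      forall x y : L, x < y -> exists z : K, x < i z < y].

End ContinuousClosure.

(* Main.v *)
(** Restricting places along R(X) -> R~(X) gives a continuous map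
    M(R~(X)) -> M(R(X)) from a compact space to a Hausdorff space, so it suffices
    that it is bijective.

    Surjectivity: every order of R(X) extends to R~(X).  The position of X with
    respect to R generates a filter on R, and in this filter every polynomial
    over R eventually has the sign that the order gives it, because it is a
    product of factors X - a and (X - b)^2 + c^2.  An ultrafilter above this
    filter orders R~(X).

    Injectivity: let P be an order of R~(X).  Since R~ is continuous closed,
    either X is infinite over R~, or X is infinitely close over R~ to some a in
    R~, or c <= |X - a| for all a in R~ and |X| <= d, where c and d are positive
    elements of R~.  In the first two cases the place of P depends only on a
    (or on X being infinite), and R(X) recognises these cases because R is dense.
    In the third case c bounds away from 0 every factor over R, hence every
    nonzero polynomial over R~ by approximating its coefficients in R, and then
    R(X) approximates every element of R~(X) uniformly. *)
Require Import Defs.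
From HB Require Import structures.
From mathcomp Require Import all_boot all_order all_algebra generic_quotient.
From mathcomp Require Import fraction finmap lra ring.
From mathcomp Require Import boolp classical_sets functions filter reals topology.
From mathcomp Require Import complex.

Set Implicit Arguments.
Unset Strict Implicit.
Unset Printing Implicit Defensive.
Import Order.TTheory GRing.Theory Num.Theory.
Local Open Scope classical_set_scope.
Local Open Scope ring_scope.

(** * The spaces of orders and places *)

Section OrderSpace.
Variable K : fieldType.
Implicit Types (P Q : field_order K) (a b : K).

Lemma order_not0 P : ~ positive P 0.
Proof. by case: (posP P). Qed.

Lemma order_antisym P a : positive P a -> ~ positive P (- a).
Proof.
case: (posP P) => P0 PD _ _ pa /(PD _ _ pa); rewrite subrr.
exact: P0.
Qed.

(** For each nonzero [a] an order contains exactly one of [a] and [- a], so no order properly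
    contains another. *)
Lemma order_incl_eq P Q : positive P `<=` positive Q -> P = Q.
Proof.
case: P Q => [P hP] [Q hQ] /= PQ.
have e : P = Q.
  apply/seteqP; split=> // a Qa.
  case: (hP) => _ _ _ /(_ a); case: eqVneq => [a0|_ /(_ isT)[//|]].
    by move: Qa; rewrite a0; case: hQ.
  by move/PQ => Qna; case: (@order_antisym (FieldOrder hQ) a).
by case: _ / e hQ {PQ} => hQ; congr FieldOrder; exact: Prop_irrelevance.
Qed.

Lemma Harrison_open a : open (Harrison a : set (field_order K)).
Proof.
have [->|a0] := eqVneq a 0.
  rewrite (_ : Harrison 0 = set0); first exact: open0.
  by rewrite -subset0 => P /order_not0.
exists [set Harrison a]; last by rewrite bigcup_set1.
move=> _ ->; exists [fset (Harrison a : set (field_order K))]%fset.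
  by move=> H /fset1P ->; rewrite inE; exists a.
by rewrite set_fset1 bigcap_set1.
Qed.

Lemma cvg_order (F : set_system (field_order K)) P : Filter F ->
  (forall a, positive P a -> F (Harrison a)) -> F --> P.
Proof.
move=> FF FP A; rewrite nbhsE => -[U [[D' hD' <-] [B D'B PB]] UA].
apply: (filterS UA); have [fs fsD eB] := hD' _ D'B.
have : F B.
  rewrite -eB; apply: filter_bigI => H Hfs.
  have := fsD _ Hfs; rewrite inE => -[a _ Ha].
  have := PB; rewrite -eB => /(_ _ Hfs).
  by rewrite Ha => /FP.
by apply: filterS => Q BQ; exists B.
Qed.

(** The limit of an ultrafilter [F] consists of the [a] that are positive for [F]-almost all orders.
    The order axioms pass to this set, the last one by maximality of [F]. *)
Lemma order_space_compact : compact [set: field_order K].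
Proof.
rewrite compact_ultra => F FU _.
have FF : ProperFilter F by exact: ultra_proper.
pose P := [set a : K | F (Harrison a)].
have hP : is_order P.
  split.
  - move=> /filter_ex[Q]; exact: order_not0.
  - move=> a b Fa Fb; apply: filterS (filterI Fa Fb) => Q [].
    by case: (posP Q) => _ PD _ _; exact: PD.
  - move=> a b Fa Fb; apply: filterS (filterI Fa Fb) => Q [].
    by case: (posP Q) => _ _ PM _; exact: PM.
  - move=> a a0; have [Fa|Fa] := in_ultra_setVsetC (Harrison a) FU; [by left|right].
    apply: filterS Fa => Q nQa; case: (posP Q) => _ _ _ /(_ a a0)[//|].
    exact.
by exists (FieldOrder hP); split=> //; apply: cvg_order.
Qed.

End OrderSpace.

(** * Compactness of the space of places *)

Section PlaceSpaceTopology.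
Variables (RR : realType) (K : fieldType).
Local Notation M := (place_space RR K).
Let proj : field_order K -> M := @place_of_order RR K.

Lemma place_space_openE (U : set M) : open U = open (proj @^-1` U).
Proof.
rewrite (_ : proj @^-1` U = \pi_M%qT @^-1` U) //.
by rewrite unlock.
Qed.

Lemma place_of_order_continuous : continuous proj.
Proof. by apply/continuousP => U; rewrite place_space_openE. Qed.

Lemma place_of_order_surj (p : M) : exists P, proj P = p.
Proof. by exists (order_of_place p); exact: order_of_placeK. Qed.

Lemma place_space_compact : compact [set: M].
Proof.
rewrite (_ : setT = proj @` setT).
  apply: continuous_compact; last exact: order_space_compact.
  exact/continuous_subspaceT/place_of_order_continuous.
by rewrite eqEsubset; split=> // p _; have [P <-] := place_of_order_surj p; exists P.
Qed.

End PlaceSpaceTopology.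

(** * Rational neighbourhoods of standard parts *)

Section StandardPartDistance.
Variables (F : realFieldType) (RR : realType).
Implicit Types (a : F) (q u w : rat).
Local Notation st := (stdpart RR).

Lemma finite_near a w u : `|a - ratr w| < ratr u -> finite_elt a.
Proof.
move=> h; rewrite -(subrK (ratr w) a); apply: finiteD; last exact: finite_rat.
exists u => //; rewrite -(ltr0q F); exact: le_lt_trans h.
Qed.

(** Passing to the standard part weakens strict inequalities; the slack between [q] and [u] makes up
    for this. No real number occurs on the right, so such conditions on places pull back to unions
    of Harrison sets. *)
Lemma stdpart_closeP a w u :
  finite_elt a /\ `|st a - ratr w| < ratr u <->
  exists2 q, q < u & `|a - ratr w| < ratr q.
Proof.
split=> [[fa /rat_in_itvoo[v]]|[q qu h]].
  rewrite in_itv /= => /andP[hv vu]; have /rat_in_itvoo[q] := vu.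
  rewrite in_itv /= !ltr_rat => /andP[vq qu]; exists q => //.
  by apply: le_lt_trans (stdpart_near fa hv) _; rewrite ltr_rat.
have fa := finite_near h; split => //.
by apply: le_lt_trans (near_stdpart RR fa h) _; rewrite ltr_rat.
Qed.

(** An infinite [a] counts as far from every rational, whence the premise on the left. *)
Lemma stdpart_farP a w u :
  (finite_elt a -> ratr u < `|st a - ratr w|) <->
  exists2 q, u < q & ratr q < `|a - ratr w|.
Proof.
split=> [h|[q uq h fa]]; last first.
  rewrite ltNge; apply/negP => h'.
  have : `|st a - ratr w| < ratr q by apply: le_lt_trans h' _; rewrite ltr_rat.
  by move=> /(stdpart_near fa); rewrite leNgt h.
have [fa|nfa] := pselect (finite_elt a).
  have /rat_in_itvoo[q] := h fa; rewrite in_itv /= => /andP[uq qs].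
  have /rat_in_itvoo[v] := uq; rewrite in_itv /= => /andP[uv vq].
  exists v; first by rewrite -(ltr_rat RR).
  rewrite ltNge; apply/negP => h'.
  have : `|a - ratr w| < ratr q.
    by apply: le_lt_trans h' _; rewrite ltr_rat -(ltr_rat RR).
  by move=> /(near_stdpart RR fa); rewrite leNgt qs.
exists (u + 1); first by rewrite ltrDl.
rewrite ltNge; apply/negP => h'; apply: nfa; apply: (@finite_near _ w (u + 2%:R)).
by apply: le_lt_trans h' _; rewrite ltr_rat ltrD2l.
Qed.

End StandardPartDistance.

Lemma real_place_Some (RR : realType) (K : fieldType) (P : field_order K) a x :
  real_place P RR a = Some x <->
  finite_elt (a : ordered P) /\ stdpart RR (a : ordered P) = x.
Proof.
rewrite real_placeE; case: valuation_ringP => h; split=> [[]|[]] //.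
by move=> _ ->.
Qed.

Lemma real_place_None (RR : realType) (K : fieldType) (P : field_order K) a :
  ~ finite_elt (a : ordered P) -> real_place P RR a = None.
Proof. by rewrite real_placeE; case: valuation_ringP. Qed.

(** * The Hausdorff property of the space of places *)

Section PlaceSpaceHausdorff.
Variables (RR : realType) (K : fieldType).
Local Notation M := (place_space RR K).

Lemma place_eq (p q : place RR K) : place_fun p =1 place_fun q -> p = q.
Proof.
case: p q => [f hf] [g hg] /= /funext e; case: _ / e hg => hg.
by congr Place; exact: Prop_irrelevance.
Qed.

(** For equal parameters [close] and [far] are disjoint open sets; places with value infinity at [a]
    lie in [far]. *)
Let close (a : K) (w u : rat) : set M :=
  [set p : M | exists2 x, place_fun p a = Some x & `|x - ratr w| < ratr u].

Let far (a : K) (w u : rat) : set M :=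
  [set p : M | forall x, place_fun p a = Some x -> ratr u < `|x - ratr w|].

Let open_close a w u : open (close a w u).
Proof.
rewrite place_space_openE (_ : _ @^-1` _ = \bigcup_(q in [set q | q < u])
    (Harrison (ratr q + (a - ratr w)) `&` Harrison (ratr q - (a - ratr w)))).
  by apply: bigcup_open => q _; apply: openI; exact: Harrison_open.
apply/seteqP; split=> P /=.
  case=> x /real_place_Some[fa <-] h.
  have /stdpart_closeP[q qu] := conj fa h.
  by move=> /ratr_pos_norm; exists q.
case=> q qu [h1 h2]; have /ratr_pos_norm h := conj h1 h2.
have /(stdpart_closeP RR)[fa hs] : exists2 q : rat, q < u &
   `|(a : ordered P) - ratr w| < ratr q by exists q.
by exists (stdpart RR (a : ordered P)) => //; apply/real_place_Some.
Qed.

Let open_far a w u : open (far a w u).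
Proof.
rewrite place_space_openE (_ : _ @^-1` _ = \bigcup_(q in [set q | u < q])
    (Harrison ((a - ratr w) - ratr q) `|` Harrison (- (a - ratr w) - ratr q))).
  by apply: bigcup_open => q _; apply: openU; exact: Harrison_open.
apply/seteqP; split=> P /=.
  move=> h; have /stdpart_farP[q uq] : finite_elt (a : ordered P) ->
      ratr u < `|stdpart RR (a : ordered P) - ratr w|.
    by move=> fa; apply: h; apply/real_place_Some.
  rewrite ltr_normr => /orP h'; exists q => //.
  by case: h' => h'; [left|right]; apply/pos_gt0; rewrite subr_gt0.
case=> q uq h x /real_place_Some[fa <-]; apply: (proj2 (stdpart_farP RR (a : ordered P) w u) _ fa).
exists q => //; rewrite ltr_normr; apply/orP.
by case: h => /pos_gt0 h; [left|right]; rewrite -subr_gt0.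
Qed.

Lemma place_space_hausdorff : hausdorff_space M.
Proof.
rewrite open_hausdorff => p q pq.
suff [a [w [u [h|h]]]] : exists a w u, (close a w u p /\ far a w u q) \/
   (close a w u q /\ far a w u p).
- exists (close a w u, far a w u); first by rewrite !inE.
  split; [exact: open_close|exact: open_far|].
  by apply/eqP; rewrite -subset0 => r [[x rx h1] /(_ x rx)]; rewrite ltNge ltW.
- exists (far a w u, close a w u); first by rewrite !inE; case: h.
  split; [exact: open_far|exact: open_close|].
  by apply/eqP; rewrite -subset0 => r [/[swap] -[x rx h1] /(_ x rx)]; rewrite ltNge ltW.
have [a pqa] : exists a, place_fun p a <> place_fun q a.
  by apply: contrapT => h; case/eqP: pq; apply: place_eq => a;
     apply: contrapT => pqa; apply: h; exists a.
exists a; move: pqa; case pa: (place_fun p a) => [x|]; case qa: (place_fun q a) => [y|] // xy.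
- have xy0 : 0 < `|y - x| / 2%:R.
    rewrite divr_gt0 // normr_gt0 subr_eq0; apply/eqP => yx.
    by apply: xy; rewrite yx.
  have /rat_in_itvoo[u] := xy0; rewrite in_itv /= => /andP[u0 uxy].
  have : x < x + ratr u by rewrite ltrDl.
  move=> /rat_in_itvoo[w]; rewrite in_itv /= => /andP[xw wu].
  exists w, u; left; split.
    by exists x => //; rewrite ltr_norml; apply/andP; split; lra.
  move=> z; rewrite qa => -[<-].
  move: uxy; rewrite ltr_pdivlMr // => uxy.
  have := ler_normD (y - ratr w) (ratr w - x); rewrite addrA subrK.
  have -> : `|ratr w - x| = ratr w - x by rewrite ger0_norm // subr_ge0 ltW.
  lra.
- have : `|x| < `|x| + 1 by rewrite ltrDl.
  move=> /rat_in_itvoo[u]; rewrite in_itv /= => /andP[xu _].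
  exists 0, u; left; split; last by move=> z; rewrite qa.
  by exists x => //; rewrite rmorph0 subr0.
- have : `|y| < `|y| + 1 by rewrite ltrDl.
  move=> /rat_in_itvoo[u]; rewrite in_itv /= => /andP[xu _].
  exists 0, u; right; split; last by move=> z; rewrite pa.
  by exists y => //; rewrite rmorph0 subr0.
Qed.

End PlaceSpaceHausdorff.

(** * Restriction of orders and places along a field morphism *)

Section Restriction.
Variables (RR : realType) (K L : fieldType) (j : {rmorphism K -> L}).

Lemma restrict_is_order (P : field_order L) : is_order [set a | positive P (j a)].
Proof.
case: (posP P) => P0 PD PM PV; split=> [|a b /=|a b /=|a a0] /=.
- by rewrite rmorph0.
- rewrite rmorphD; exact: PD.
- rewrite rmorphM; exact: PM.
- by rewrite rmorphN; apply: PV; rewrite fmorph_eq0.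
Qed.

Definition restrict_order (P : field_order L) : field_order K :=
  FieldOrder (restrict_is_order P).

Lemma restrict_order_lt (P : field_order L) (a b : ordered (restrict_order P)) :
  ((j a : ordered P) < j b) = (a < b).
Proof.
rewrite -subr_gt0 -[RHS]subr_gt0; apply/idP/idP => /pos_gt0.
  by move=> h; apply/pos_gt0; rewrite /= rmorphB.
by move=> h; apply/pos_gt0; move: h; rewrite /= rmorphB.
Qed.

Lemma restrict_order_continuous : continuous restrict_order.
Proof.
move=> P; apply: cvg_order => [|a Pa].
  by apply: fmap_filter; exact: nbhs_filter.
change (nbhs P (Harrison (j a))).
by apply: open_nbhs_nbhs; split; [exact: Harrison_open|].
Qed.

(** A place only records comparisons with rationals, and [j] fixes these. *)
Lemma real_place_restrict (P : field_order L) (a : K) :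
  real_place (restrict_order P) RR a = real_place P RR (j a).
Proof.
have jq (q : rat) : j (ratr q) = ratr q by exact: fmorph_rat.
have e : finite_elt (a : ordered (restrict_order P)) <->
         finite_elt (j a : ordered P).
  split=> -[q q0 h]; exists q => //; move: h; rewrite !ltr_norml => /andP[h1 h2].
    by apply/andP; split; [move: h1|move: h2];
      rewrite -restrict_order_lt ?rmorphN /= jq.
  by apply/andP; split; [move: h1|move: h2];
      rewrite -restrict_order_lt ?rmorphN /= jq.
have [fa|nfa] := pselect (finite_elt (a : ordered (restrict_order P))); last first.
  by rewrite !real_place_None // -e.
transitivity (Some (stdpart RR (a : ordered (restrict_order P)))).
  exact/real_place_Some.
apply/esym/real_place_Some; split; first exact/e.
rewrite /stdpart; congr sup; apply/seteqP; split=> x [q /= h <-]; exists q => //=.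
  by rewrite -restrict_order_lt jq.
by rewrite -jq restrict_order_lt.
Qed.

Lemma restrict_place_subproof (p : place RR L) :
  exists P : field_order K, real_place P RR = place_fun p \o j.
Proof.
have [P Pp] := placeP p; exists (restrict_order P).
by apply/funext => a; rewrite real_place_restrict Pp.
Qed.

Definition restrict_place (p : place_space RR L) : place_space RR K :=
  Place (restrict_place_subproof p).

Lemma restrict_place_of_order (P : field_order L) :
  restrict_place (place_of_order RR P) = place_of_order RR (restrict_order P).
Proof. by apply: place_eq => a /=; rewrite real_place_restrict. Qed.

Lemma restrict_place_continuous : continuous restrict_place.
Proof.
apply/continuousP => U oU; rewrite place_space_openE.
rewrite (_ : _ @^-1` _ = restrict_order @^-1` (@place_of_order RR K @^-1` U)).
  apply: (proj1 (continuousP _)); first exact: restrict_order_continuous.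
  by rewrite -place_space_openE.
by apply/seteqP; split=> P /=; rewrite restrict_place_of_order.
Qed.

End Restriction.

Lemma compact_hausdorff_homeomorphic (S T : topologicalType) (f : S -> T) :
  compact [set: S] -> hausdorff_space T -> continuous f ->
  injective f -> (forall y, exists x, f x = y) -> homeomorphic S T.
Proof.
move=> cS hT cf fI fS; pose g y := projT1 (cid (fS y)).
have gK : cancel g f by move=> y; rewrite /g; case: cid.
have fK : cancel f g by move=> x; apply: fI; rewrite gK.
exists f, g; split=> //; apply/continuous_closedP => A cA.
rewrite (_ : g @^-1` A = f @` A).
  apply: compact_closed => //; apply: continuous_compact.
    exact: continuous_subspaceT.
  exact: subclosed_compact cA cS _.
apply/seteqP; split=> y /=; first by exists (g y).
by case=> x Ax <-; rewrite fK.
Qed.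

Lemma homeomorphic_sym (S T : topologicalType) :
  homeomorphic S T -> homeomorphic T S.
Proof. by move=> [f [g [fK gK cf cg]]]; exists g, f. Qed.

(** * Extending orders *)

Section FractionLift.
Variable A : idomainType.

Lemma fraction_split (x : {fraction A}) :
  {pq : A * A | pq.2 != 0 & x = tofrac pq.1 / tofrac pq.2}.
Proof.
elim/quotW: x => r; exists (\n_r, \d_r) => /=; first exact: denom_ratioP.
apply: (canRL (mulfK _)); first by rewrite tofrac_eq0 denom_ratioP.
unlock FracField.tofrac; rewrite -[LHS]FracField.pi_mul; apply/eqmodP.
rewrite /= FracField.equivfE /FracField.mulf.
by rewrite !numden_Ratio ?mulr1 ?oner_neq0 ?denom_ratioP // mulrC.
Qed.

Variables (F : fieldType) (h : {rmorphism A -> F}).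
Hypothesis h_inj : injective h.

Definition frac_lift (x : {fraction A}) : F :=
  h (sval (fraction_split x)).1 / h (sval (fraction_split x)).2.

Lemma frac_lift_div p q : q != 0 -> frac_lift (tofrac p / tofrac q) = h p / h q.
Proof.
have hn0 r : r != 0 -> h r != 0 by rewrite -(inj_eq h_inj) rmorph0.
move=> q0; rewrite /frac_lift; case: fraction_split => -[n d] /= d0 /eqP.
rewrite eqr_div ?tofrac_eq0 // -!tofracM tofrac_eq => /eqP e.
by apply/eqP; rewrite eqr_div ?hn0 // -!rmorphM e.
Qed.

Lemma frac_lift_tofrac p : frac_lift (tofrac p) = h p.
Proof.
by have := frac_lift_div p (oner_neq0 A); rewrite !rmorph1 !divr1.
Qed.

Let liftB : zmod_morphism frac_lift.
Proof.
have hn0 r : r != 0 -> h r != 0 by rewrite -(inj_eq h_inj) rmorph0.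
move=> x y; have [[p q] /= q0 ->] := fraction_split x.
have [[r s] /= s0 ->] := fraction_split y.
rewrite -mulNr addf_div ?tofrac_eq0 // -tofracN -!tofracM -tofracD.
rewrite !frac_lift_div ?mulf_neq0 // -mulNr addf_div ?hn0 //.
by rewrite rmorphD !rmorphM rmorphN.
Qed.

Let liftM : monoid_morphism frac_lift.
Proof.
split=> [|x y]; first by rewrite -tofrac1 frac_lift_tofrac rmorph1.
have [[p q] /= q0 ->] := fraction_split x.
have [[r s] /= s0 ->] := fraction_split y.
by rewrite mulf_div -!tofracM !frac_lift_div ?mulf_neq0 // !rmorphM mulf_div.
Qed.

HB.instance Definition _ := GRing.isZmodMorphism.Build _ _ frac_lift liftB.
HB.instance Definition _ := GRing.isMonoidMorphism.Build _ _ frac_lift liftM.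

Lemma frac_lift_exists : exists j : {rmorphism {fraction A} -> F},
  forall p, j (tofrac p) = h p.
Proof. by exists frac_lift; exact: frac_lift_tofrac. Qed.

End FractionLift.

(** Take a root [b + c i] in the algebraically closed field [complex R]. If [c = 0] then [X - b]
    divides [p], otherwise the quadratic with roots [b + c i] and [b - c i] does. Induction applies
    to the cofactor. *)
Lemma rcf_poly_ind (R : rcfType) (T : {poly R} -> Prop) :
  (forall c, T c%:P) -> (forall p q, T p -> T q -> T (p * q)) ->
  (forall a, T ('X - a%:P)) ->
  (forall b c, c != 0 -> T (('X - b%:P) ^+ 2 + (c ^+ 2)%:P)) ->
  forall p, T p.
Proof.
move=> TC TM TX TQ p; have [n] := ubnP (size p); elim: n p => // n IH p.
rewrite ltnS => sp; have [s1|s1] := leqP (size p) 1; first by rewrite (size1_polyC s1).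
have p0 : p != 0 by rewrite -size_poly_gt0 (leq_trans _ s1).
pose toC := real_complex R : {rmorphism R -> complex R}.
have /closed_rootP[[b c] /eqP pz] : size (map_poly toC p) != 1%N.
  by rewrite size_map_poly gtn_eqF.
have divide d : d %| p -> (1 < size d)%N -> T d -> T p.
  move=> /dvdpP[q pq] sd Td; rewrite pq; apply: TM => //; apply: IH.
  have d0 : d != 0 by rewrite -size_poly_gt0 (leq_trans _ sd).
  have q0 : q != 0 by apply: contra_neq p0 => q0; rewrite pq q0 mul0r.
  apply: leq_trans sp; rewrite pq size_mul //.
  by case: (size d) sd => [|[|k]] // _; rewrite !addnS /= ltnS leq_addr.
have [c0|c0] := eqVneq c 0.
  apply: (divide ('X - b%:P)) => //; last by rewrite size_XsubC.
  rewrite dvdp_XsubCl; apply/rootP/complexI.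
  by move: pz; rewrite c0 -(horner_map toC) rmorph0.
pose d := ('X - b%:P) ^+ 2 + (c ^+ 2)%:P.
have sd : size d = 3%N.
  rewrite size_polyDl size_exp_XsubC // size_polyC.
  by case: (_ != _).
apply: (divide d); rewrite ?sd //; last exact: TQ.
rewrite /dvdp -size_poly_eq0 -leqn0.
have pE := divp_eq p d; set r := p %% d in pE *.
have sr : (size r <= 2)%N by rewrite -ltnS -sd ltn_modp -size_poly_gt0 sd.
have dz : (map_poly toC d).[Complex b c] = 0.
  rewrite rmorphD rmorphXn rmorphB /= map_polyX !map_polyC /= !hornerE /=.
  by rewrite expr2; apply/eqP; rewrite eq_complex /=; apply/andP; split; apply/eqP; ring.
have : (map_poly toC r).[Complex b c] = 0.
  by move: pz; rewrite pE rmorphD rmorphM /= hornerD hornerM dz mulr0 add0r.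
(* The remainder is [r0 + r1 X] over [R]. Its imaginary part at the root is [r1 c], so [c != 0]
   forces [r1 = 0], and then [r0 = 0]. *)
rewrite (@horner_coef_wide _ 2) ?size_map_poly // !big_ord_recl big_ord0 !coef_map /=.
rewrite expr0 expr1 mulr1 addr0 => /eqP; rewrite eq_complex /=.
rewrite !(mul0r, subr0, addr0, add0r) => /andP[/eqP h1].
rewrite mulf_eq0 (negPf c0) orbF => /eqP h2.
move: h1; rewrite h2 mul0r addr0 => h1.
rewrite leqn0 size_poly_eq0; apply/eqP/polyP => -[|[|k]]; rewrite coef0 //.
by rewrite nth_default // (leq_trans sr).
Qed.

(** * Orders of L(X) from ultrafilters *)

Section UltrafilterOrder.
Variables (T : Type) (L : realFieldType) (e : T -> L) (G : set_system T).
Hypothesis GU : UltraFilter G.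
Hypothesis G_nonroot : forall q : {poly L}, q != 0 -> G [set t | q.[e t] != 0].

(** This is the order pulled back from the ultrapower of [L] by sending [X] to the class of [e]. The
    quotient [p / q] has the sign of [p * q], which avoids dividing by values of [q]. *)
Definition ultra_positive : set {fraction {poly L}} :=
  [set f | exists p q, f = tofrac p / tofrac q /\ G [set t | 0 < p.[e t] * q.[e t]]].

Lemma ultra_positive_order : is_order ultra_positive.
Proof.
have GP : ProperFilter G by exact: ultra_proper.
have den0 (p q : {poly L}) : G [set t | 0 < p.[e t] * q.[e t]] -> p != 0 /\ q != 0.
  move=> /filter_ex[t /=]; case: eqVneq => [->|_]; first by rewrite horner0 mul0r ltxx.
  by case: eqVneq => [->|//]; rewrite horner0 mulr0 ltxx.
split.
- move=> [p [q [e0 /den0[p0 q0]]]]; move/esym/eqP: e0.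
  by rewrite mulf_eq0 invr_eq0 !tofrac_eq0 (negPf p0) (negPf q0).
- move=> _ _ [p [q [-> Gpq]]] [r [s [-> Grs]]].
  have [_ q0] := den0 _ _ Gpq; have [_ s0] := den0 _ _ Grs.
  exists (p * s + r * q), (q * s); split.
    by rewrite addf_div ?tofrac_eq0 // tofracD !tofracM.
  apply: filterS (filterI Gpq Grs) => t /= [h1 h2]; rewrite !(hornerM, hornerD).
  have q1 : q.[e t] != 0 by apply: contraTneq h1 => ->; rewrite mulr0 ltxx.
  have s1 : s.[e t] != 0 by apply: contraTneq h2 => ->; rewrite mulr0 ltxx.
  rewrite [ltRHS](_ : _ = p.[e t] * q.[e t] * s.[e t] ^+ 2 +
                         r.[e t] * s.[e t] * q.[e t] ^+ 2); last by ring.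
  by rewrite addr_gt0 // mulr_gt0 // exprn_even_gt0 //= ?orbT.
- move=> _ _ [p [q [-> Gpq]]] [r [s [-> Grs]]].
  exists (p * r), (q * s); split; first by rewrite mulf_div !tofracM.
  apply: filterS (filterI Gpq Grs) => t /= [h1 h2]; rewrite !(hornerM, hornerD).
  by rewrite mulrACA mulr_gt0.
- move=> a; have [[p q] /= q0 ->] := fraction_split a.
  rewrite mulf_eq0 invr_eq0 !tofrac_eq0 (negPf q0) orbF => p0.
  (* The product is nonzero on a set of [G], so where it is not positive it is negative. *)
  have Gpq := G_nonroot (mulf_neq0 p0 q0).
  have [h|h] := in_ultra_setVsetC [set t | 0 < p.[e t] * q.[e t]] GU.
    by left; exists p, q.
  right; exists (- p), q; split; first by rewrite tofracN mulNr.
  apply: filterS (filterI Gpq h) => t /= []; rewrite hornerM hornerN => h1 /negP h2.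
  by rewrite mulNr oppr_gt0 lt_neqAle h1 leNgt.
Qed.

End UltrafilterOrder.

(** Finitely many conditions of a cut can be met at once, since an ordered field is dense in itself
    and has no endpoints. The lower half [B] may be empty or everything. *)
Lemma finite_cut_point (R : realFieldType) (B : {pred R}) (s : seq R) :
  (forall a b, B a -> ~~ B b -> a < b) ->
  exists t, forall a, a \in s -> if B a then a < t else t < a.
Proof.
move=> BP.
(* Keeping [lo] in [B] and [hi] outside preserves [lo < hi] as [s] grows. If one half of the cut is
   empty, its bound is arbitrary and is moved out of the way. *)
suff [lo [hi [lohi [lo_inv [hi_inv h]]]]] : exists lo hi, lo < hi /\
    (B lo \/ forall a, ~~ B a) /\ (~~ B hi \/ forall a, B a) /\
    forall a, a \in s -> if B a then a <= lo else hi <= a.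
  exists ((lo + hi) / 2%:R) => a /h; case: ifP => _ ha.
    by apply: le_lt_trans ha _; rewrite midf_lt.
  by apply: lt_le_trans ha; rewrite midf_lt.
elim: s => [|a s [lo [hi [lohi [lo_inv [hi_inv h]]]]]].
  have [[lo Blo]|nlo] := pselect (exists a, B a); last first.
    have nB a : ~~ B a by apply/negP => Ba; apply: nlo; exists a.
    by exists 0, 1; split=> //; split; [right|split=> //; left].
  have [[hi Bhi]|nhi] := pselect (exists a, ~~ B a).
    by exists lo, hi; split; [exact: BP|split; [left|split=> //; left]].
  have aB a : B a by apply/negPn/negP => Ba; apply: nhi; exists a.
  by exists 0, 1; split=> //; split; [left|split=> //; right].
have [Ba|Ba] := boolP (B a).
  have {}lo_inv : B lo by case: lo_inv => // /(_ a); rewrite Ba.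
  have Bm : B (Num.max lo a) by rewrite maxEle; case: ifP.
  exists (Num.max lo a), (if B hi then Num.max lo a + 1 else hi); split.
    by case: ifP => [_|/negbT Bhi]; [rewrite ltrDl|exact: BP].
  split; first by left.
  split.
    case: ifP hi_inv => Bhi; first by case=> [|aB]; [|right].
    by left; rewrite Bhi.
  move=> b; rewrite inE => /orP[/eqP ->|/h]; first by rewrite Ba le_max lexx orbT.
  case: ifP => [_ h'|/negbT Bb]; first by rewrite le_max h'.
  by case: ifP hi_inv => // Bhi [|/(_ b)]; rewrite ?Bhi // (negPf Bb).
have {}hi_inv : ~~ B hi by case: hi_inv => // /(_ a); rewrite (negPf Ba).
have Bm : ~~ B (Num.min hi a) by rewrite minEle; case: ifP.
exists (if B lo then lo else Num.min hi a - 1), (Num.min hi a); split.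
  by case: ifP => [Blo|_]; [exact: BP|rewrite ltrBlDr ltrDl].
split.
  case: ifP lo_inv => Blo; first by left.
  by case=> [|nB]; [rewrite ?Blo|right].
split; first by left.
move=> b; rewrite inE => /orP[/eqP ->|/h].
  by rewrite (negPf Ba) ge_min lexx orbT.
case: ifP => [Bb|_ h']; last by rewrite ge_min h'.
by case: ifP lo_inv => // /negbT Blo [|/(_ b)]; rewrite ?(negPf Blo) // Bb.
Qed.

Lemma poly_roots_along (T : eqType) (L : idomainType) (e : T -> L) (q : {poly L}) :
  injective e -> q != 0 -> exists s : seq T, forall t, root q (e t) -> t \in s.
Proof.
move=> eI; have [n] := ubnP (size q); elim: n q => // n IH q sq q0.
have [[t rt]|nrt] := pselect (exists t, root q (e t)); last first.
  by exists [::] => t rt; case: nrt; exists t.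
have /factor_theorem[r qr] := rt.
have r0 : r != 0 by apply: contra_neq q0 => r0; rewrite qr r0 mul0r.
have [s hs] : exists s : seq T, forall t, root r (e t) -> t \in s.
  by apply: IH => //; move: sq; rewrite qr size_Mmonic ?monicXsubC // size_XsubC addn2.
exists (t :: s) => u; rewrite qr rootM root_XsubC inE => /orP[/hs ->|/eqP/eI ->].
  by rewrite orbT.
by rewrite eqxx.
Qed.

(** * Extension of orders from R(X) to L(X) *)

Section OrderExtension.
Variables (R : rcfType) (L : realFieldType) (i : {rmorphism R -> L}).
Variable j : {rmorphism {fraction {poly R}} -> {fraction {poly L}}}.
Hypothesis i_lt : {homo i : x y / x < y}.
Hypothesis jE : forall p, j (tofrac p) = tofrac (map_poly i p).

Section CutFilter.
Variable P : field_order {fraction {poly R}}.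
Let h : {rmorphism {poly R} -> ordered P} := @tofrac {poly R}.

(** Nonnegative elements of the real closed field [R] are squares, so [P] induces the given order on
    constants. *)
Let h_const_ge0 c : 0 <= c -> 0 <= h c%:P.
Proof. by move=> /sqr_sqrtr <-; rewrite rmorphXn rmorphXn /= sqr_ge0. Qed.

Let h_const_gt0 c : 0 < h c%:P -> 0 < c.
Proof.
rewrite !ltNge; apply: contra => c0; rewrite -oppr_ge0 -rmorphN -polyCN.
by apply: h_const_ge0; rewrite oppr_ge0.
Qed.

Let h_eq0 p : (h p == 0) = (p == 0).
Proof. exact: tofrac_eq0. Qed.

(* The elements of R below X. *)
Let below : {pred R} := [pred a | 0 < h ('X - a%:P)].

(** A base is formed by the sets of points lying on the same side as [X] of each element of a finite
    list; such points avoid the list. *)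
Let cut_filter : set_system R := [set S | exists s : seq R,
  forall t, (forall a, a \in s -> if below a then a < t else t < a) -> S t].

Let cut_filter_proper : ProperFilter cut_filter.
Proof.
split.
  move=> [s hs]; have [a b Ba Bb|t /hs //] := @finite_cut_point R below s.
  rewrite -subr_gt0; apply: h_const_gt0.
  rewrite (_ : (b - a)%:P = ('X - a%:P) - ('X - b%:P)); last by rewrite polyCB; ring.
  rewrite rmorphB subr_gt0; apply: le_lt_trans Ba.
  by rewrite leNgt.
split; first by exists [::].
  move=> S T [s hs] [s' hs']; exists (s ++ s') => t ht; split.
    by apply: hs => a sa; apply: ht; rewrite mem_cat sa.
  by apply: hs' => a sa; apply: ht; rewrite mem_cat sa orbT.
by move=> S T ST [s hs]; exists s => t /hs /ST.
Qed.

(** Signs multiply, so factors suffice: the list [[:: a]] decides the sign of [X - a], and a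
    quadratic factor is positive at every point and not negative under [P]. *)
Let cut_filter_sign p :
  (0 < h p -> cut_filter [set t | 0 < p.[t]]) /\
  (h p < 0 -> cut_filter [set t | p.[t] < 0]).
Proof.
have FF : Filter cut_filter by exact: filter_filter.
elim/rcf_poly_ind: p => [c|p q [p1 p2] [q1 q2]|a|b c c0].
- split=> hc; apply: filterE => t /=; rewrite hornerC; first exact: h_const_gt0.
  by rewrite -oppr_gt0; apply: h_const_gt0; rewrite polyCN rmorphN oppr_gt0.
- rewrite rmorphM; split; case: (ltgtP (h p) 0) => hp; rewrite ?hp ?mul0r ?ltxx //.
  + rewrite nmulr_rgt0 // => hq; apply: filterS (filterI (p2 hp) (q2 hq)) => t [] /=.
    by rewrite hornerM => h1 h2; rewrite nmulr_rgt0.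
  + rewrite pmulr_rgt0 // => hq; apply: filterS (filterI (p1 hp) (q1 hq)) => t [] /=.
    by rewrite hornerM => h1 h2; rewrite pmulr_rgt0.
  + rewrite nmulr_rlt0 // => hq; apply: filterS (filterI (p2 hp) (q1 hq)) => t [] /=.
    by rewrite hornerM => h1 h2; rewrite nmulr_rlt0.
  + rewrite pmulr_rlt0 // => hq; apply: filterS (filterI (p1 hp) (q2 hq)) => t [] /=.
    by rewrite hornerM => h1 h2; rewrite pmulr_rlt0.
- split=> ha; exists [:: a] => t /(_ a (mem_head _ _)); rewrite /mkset hornerXsubC.
    by case: ifP => [_|/negP/(_ ha) //]; rewrite subr_gt0.
  by case: ifP => [/lt_trans/(_ ha)|_]; rewrite ?ltxx // subr_lt0.
- split=> [_|].
    apply: filterE => t /=; rewrite !hornerE ltr_wpDl ?sqr_ge0 //.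
    by rewrite exprn_even_gt0 //= c0.
  by rewrite ltNge rmorphD rmorphXn addr_ge0 // ?sqr_ge0 // h_const_ge0 // sqr_ge0.
Qed.

Lemma restrict_order_surj : exists Q, restrict_order j Q = P.
Proof.
have [G [GU FG]] := ultraFilterLemma cut_filter_proper.
have GP : ProperFilter G by exact: ultra_proper.
(* A nonzero [q] has finitely many roots in the image of [i], and some set of the cut filter avoids
   them. *)
have Gnr (q : {poly L}) : q != 0 -> G [set t | q.[i t] != 0].
  move=> /(poly_roots_along (fmorph_inj i))[s hs]; apply: FG; exists s => t ht /=.
  apply/negP => /hs /[dup] ts /ht; case: ifP; by rewrite ltxx.
exists (FieldOrder (ultra_positive_order GU Gnr)); apply/esym/order_incl_eq => f Pf.
have [[p q] /= q0 fE] := fraction_split f; rewrite {f}fE in Pf *.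
exists (map_poly i p), (map_poly i q); split; first by rewrite fmorph_div !jE.
have : 0 < h (p * q).
  have /pos_gt0 f0 := Pf; have hq0 : h q != 0 by rewrite h_eq0.
  rewrite (_ : h (p * q) = (tofrac p / tofrac q : ordered P) * h q ^+ 2).
    by rewrite mulr_gt0 // exprn_even_gt0 //= ?orbT.
  by rewrite expr2 mulrA divfK // rmorphM.
move=> /(proj1 (cut_filter_sign _)) /FG; apply: filterS => t /=.
by rewrite !horner_map -rmorphM -hornerM => /i_lt; rewrite rmorph0.
Qed.

End CutFilter.

End OrderExtension.

(** * Places agreeing at an element *)

Section MonotoneMorphism.
Variables (L O : realFieldType) (k : {rmorphism L -> O}).
Hypothesis k_lt : {homo k : x y / x < y}.

Lemma monotone_le : {mono k : x y / x <= y}.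
Proof. exact: le_mono. Qed.

Lemma monotone_lt : {mono k : x y / x < y}.
Proof. exact/leW_mono/monotone_le. Qed.

Lemma monotone_gt0 c : (0 < k c) = (0 < c).
Proof. by rewrite -monotone_lt rmorph0. Qed.

Lemma monotone_norm c : k `|c| = `|k c|.
Proof.
have [c0|c0] := leP 0 c.
  by rewrite !ger0_norm // -(rmorph0 k) monotone_le.
by rewrite !ltr0_norm ?rmorphN // -(rmorph0 k) monotone_lt.
Qed.

End MonotoneMorphism.

Section SamePlace.
Variables O1 O2 : realFieldType.

(* Says that x1 and x2 are both infinite, or both finite with the same standard
   part, without mentioning the reals. *)
Definition same_place (x1 : O1) (x2 : O2) := forall w u v : rat, u < v ->
  (`|x1 - ratr w| < ratr u -> `|x2 - ratr w| < ratr v) /\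
  (`|x2 - ratr w| < ratr u -> `|x1 - ratr w| < ratr v).

Lemma same_place_limit (x1 : O1) (x2 : O2) :
  (forall e : rat, 0 < e -> exists y1 y2,
     [/\ same_place y1 y2, `|x1 - y1| < ratr e & `|x2 - y2| < ratr e]) ->
  same_place x1 x2.
Proof.
(* Passing from [x1] to [y1] and from [y2] to [x2] costs [e] each time, and [u + e < v - e] leaves
   room in between. *)
move=> h w u v uv; pose e := (v - u) / 3%:R.
have e0 : 0 < e by rewrite divr_gt0 // subr_gt0.
have [y1 [y2 [ys h1 h2]]] := h _ e0.
have [s1 s2] : (`|y1 - ratr w| < ratr (u + e) -> `|y2 - ratr w| < ratr (v - e)) /\
               (`|y2 - ratr w| < ratr (u + e) -> `|y1 - ratr w| < ratr (v - e)).
  by apply: ys; rewrite /e; lra.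
have t (O : realFieldType) (x y z : O) (a : rat) :
    `|x - y| < ratr e -> `|x - z| < ratr a -> `|y - z| < ratr (a + e).
  rewrite rmorphD /= => g1 g2; have := ler_normD (y - x) (x - z).
  rewrite addrA subrK (distrC y x); lra.
split=> g.
  have /s1/(t _ y2 x2) : `|y1 - ratr w| < ratr (u + e) by exact: t g.
  by rewrite distrC subrK; exact.
have /s2/(t _ y1 x1) : `|y2 - ratr w| < ratr (u + e) by exact: t g.
by rewrite distrC subrK; exact.
Qed.

(** Both implications in [same_place] have false premises. *)
Lemma same_place_infinite (x1 : O1) (x2 : O2) :
  (forall q : rat, ratr q < `|x1|) -> (forall q : rat, ratr q < `|x2|) ->
  same_place x1 x2.
Proof.
have t (O : realFieldType) (x : O) (w u : rat) :
    (forall q : rat, ratr q < `|x|) -> `|x - ratr w| < ratr u -> False.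
  move=> /(_ (u + `|w|)); rewrite rmorphD /= ratr_norm => g1 g2.
  have := ler_normD (x - ratr w) (ratr w); rewrite subrK; lra.
by move=> h1 h2 w u v _; split=> /t -[].
Qed.

Lemma same_place_morph (L : realFieldType) (k1 : {rmorphism L -> O1})
  (k2 : {rmorphism L -> O2}) c :
  {homo k1 : x y / x < y} -> {homo k2 : x y / x < y} ->
  same_place (k1 c) (k2 c).
Proof.
have t (O : realFieldType) (k : {rmorphism L -> O}) (w u : rat) :
    {homo k : x y / x < y} -> (`|k c - ratr w| < ratr u) = (`|c - ratr w| < ratr u).
  move=> kP; rewrite -(fmorph_rat k w) -rmorphB -monotone_norm //.
  by rewrite -(fmorph_rat k u) monotone_lt.
move=> h1 h2 w u v uv; rewrite !t //.
have uvL : (ratr u : L) < ratr v by rewrite ltr_rat.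
by split=> /lt_trans; apply.
Qed.

End SamePlace.

Lemma same_place_sym (O1 O2 : realFieldType) (x1 : O1) (x2 : O2) :
  same_place x1 x2 -> same_place x2 x1.
Proof. by move=> h w u v /(h w)[]. Qed.

Lemma real_place_same (RR : realType) (K : fieldType) (P1 P2 : field_order K) (f : K) :
  real_place P1 RR f = real_place P2 RR f <->
  same_place (f : ordered P1) (f : ordered P2).
Proof.
have dir (P Q : field_order K) : real_place P RR f = real_place Q RR f ->
    forall w u v : rat, u < v ->
    `|(f : ordered P) - ratr w| < ratr u -> `|(f : ordered Q) - ratr w| < ratr v.
  move=> e w u v uv h.
  have [fP sP] : finite_elt (f : ordered P) /\
     `|stdpart RR (f : ordered P) - ratr w| < ratr v.
    by apply/stdpart_closeP; exists u.
  have /real_place_Some : real_place P RR f = Some (stdpart RR (f : ordered P)).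
    exact/real_place_Some.
  have : real_place P RR f = Some (stdpart RR (f : ordered P)).
    exact/real_place_Some.
  rewrite e => /real_place_Some[fQ sQ] _.
  have [q qv hq] : exists2 q, q < v & `|(f : ordered Q) - ratr w| < ratr q.
    by apply/(stdpart_closeP RR); split; rewrite ?sQ.
  by apply: lt_trans hq _; rewrite ltr_rat.
split=> [e w u v uv|h]; first by split; exact: dir.
have fin (P Q : field_order K) : same_place (f : ordered P) (f : ordered Q) ->
    finite_elt (f : ordered P) -> finite_elt (f : ordered Q).
  move=> s [q q0 fq].
  have {fq} : `|(f : ordered P) - ratr 0| < ratr q by rewrite rmorph0 subr0.
  have q1 : q < q + 1 by rewrite ltrDl.
  by move=> /(proj1 (s 0 _ _ q1)) /finite_near.
have [f1|f1] := pselect (finite_elt (f : ordered P1)); last first.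
  rewrite !real_place_None // => /(fin _ _ (same_place_sym h)).
  exact: f1.
have f2 := fin _ _ h f1.
rewrite (proj2 (@real_place_Some RR K P1 f _) (conj f1 erefl)).
rewrite (proj2 (@real_place_Some RR K P2 f _) (conj f2 erefl)); congr Some.
(* A rational [w] within [e] of the first standard part is within [3 e] of the second. *)
apply: (@rat_small_eq _ _ _ 4%:R) => // e e0 _.
have [w [h1 h2]] := stdpart_approx RR f1 e0.
have : `|(f : ordered P2) - ratr w| < ratr (e *+ 3).
  have e23 : e *+ 2 < e *+ 3 by rewrite ltr_pMn2l.
  apply: (proj1 (h w _ _ e23)).
  by apply: le_lt_trans h2 _; rewrite ltr_rat mulr2n ltrDl.
move=> /(near_stdpart RR f2); rewrite rmorphMn rmorphM rmorph_nat /= => h3.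
have := ler_normD (stdpart RR (f : ordered P1) - ratr w) (ratr w - stdpart RR (f : ordered P2)).
by rewrite addrA subrK (distrC (ratr w)); lra.
Qed.

(** * Evaluation of polynomials at an element of an ordered extension *)

(** This is what makes every order of [L(X)] induce the given order on [L]. The cut at the square
    root of [y] is normal, because [y] is approximated by elements of [R], which have roots. Hence
    it is principal, and the greatest element of its lower half squares to [y]. *)
Lemma continuous_closed_sqrt (R : rcfType) (L : realFieldType)
    (i : {rmorphism R -> L}) (y : L) :
  continuous_closure i -> 0 < y -> exists x, y = x ^+ 2.
Proof.
move=> [i_lt Lcc dense] y0.
have i_ge0 z : 0 < i z -> 0 < z by rewrite -(monotone_gt0 i_lt).
have [z0 /andP[iz0 z0y]] := dense _ _ y0.
pose m := i (Num.sqrt z0).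
have m0 : 0 < m by rewrite (monotone_gt0 i_lt) sqrtr_gt0 i_ge0.
have isqrt z : 0 < i z -> i (Num.sqrt z) ^+ 2 = i z.
  by move=> /i_ge0 z_gt0; rewrite -rmorphXn sqr_sqrtr // ltW.
pose A := [set x : L | x <= 0 \/ x ^+ 2 <= y].
pose B := [set x : L | 0 < x /\ y < x ^+ 2].
have cutAB : is_cut A B.
  split.
    rewrite -subTset => x _; have [x0|x0] := leP x 0; first by left; left.
    by have [xy|xy] := leP (x ^+ 2) y; [left; right|right; split].
  move=> a b [a0 [b0 _]|ay [b0 yb]]; first exact: le_lt_trans b0.
  rewrite ltNge; apply/negP => ba.
  have : b ^+ 2 <= a ^+ 2 by rewrite ler_sqr // nnegrE ?ltW // (lt_le_trans b0).
  by move=> /le_trans/(_ ay); rewrite leNgt yb.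
have normAB : normal_cut A B.
  (* Elements [z'] and [z] of [R] within [d] of [y] on either side have roots whose squares differ
     by less than [2 d = c m]. Taking [z'] above [z0] makes the sum of the roots exceed [m], so the
     roots differ by less than [c]. *)
  move=> c c0; pose d := c * m / 2%:R.
  have d0 : 0 < d by rewrite divr_gt0 // mulr_gt0.
  have : Num.max (i z0) (y - d) < y by rewrite gt_max z0y ltrBlDr ltrDl d0.
  move=> /dense[z' /andP[]]; rewrite gt_max => /andP[z0z' dz'] z'y.
  have : y < y + d by rewrite ltrDl.
  move=> /dense[z /andP[yz zd]].
  have iz'0 := lt_trans iz0 z0z'; have iz_gt0 := lt_trans y0 yz.
  have z'z : z' < z by rewrite -(monotone_lt i_lt) (lt_trans z'y).
  exists (i (Num.sqrt z')), (i (Num.sqrt z)).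
  have ma : m < i (Num.sqrt z').
    by rewrite (monotone_lt i_lt) ltr_sqrt ?i_ge0 // -(monotone_lt i_lt).
  have b0 : 0 < i (Num.sqrt z).
    by rewrite (monotone_gt0 i_lt) sqrtr_gt0 i_ge0.
  split; first by right; rewrite isqrt // ltW.
    by split=> //; rewrite isqrt.
  set a := i (Num.sqrt z') in ma *; set b := i (Num.sqrt z) in b0 *.
  have ab : b ^+ 2 - a ^+ 2 < c * m by rewrite !isqrt // /d in dz' zd *; lra.
  have : (b - a) * (b + a) < c * m by apply: le_lt_trans ab; rewrite subr_sqr.
  by rewrite ltNge; apply: contraNlt => cab; apply: ler_pM; lra.
case: (Lcc _ _ cutAB normAB) => [[a Aa amax]|[b [b0 yb] bmin]].
  have a0 : 0 < a.
    by apply: lt_le_trans (amax m _) => //; right; rewrite isqrt // ltW.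
  exists a; apply/eqP; rewrite eq_le; apply/andP; split; last first.
    by case: Aa => // /(lt_le_trans a0); rewrite ltxx.
  rewrite leNgt; apply/negP => ay.
  (* This gives [(a + c)^2 <= a^2 + c (2 a + 1) <= y], whereas some element of [B] lies below
     [a + c]. *)
  pose c := Num.min 1 ((y - a ^+ 2) / (2%:R * a + 1)).
  have c0 : 0 < c by rewrite lt_min ltr01 divr_gt0 ?subr_gt0 //; lra.
  have [a' [b' [Aa' [b'0 yb'] cab]]] := normAB _ c0.
  have b'a : b' < a + c by have := amax _ Aa'; lra.
  have : b' ^+ 2 < (a + c) ^+ 2 by rewrite ltr_sqr ?nnegrE //; lra.
  have c1 : c <= 1 by rewrite ge_min lexx.
  have : c * (2%:R * a + 1) <= y - a ^+ 2.
    by rewrite -ler_pdivlMr ?ge_min ?lexx ?orbT //; lra.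
  have : c * c <= c * 1 by rewrite ler_pM2l.
  by rewrite sqrrD; move: yb'; lra.
(* This case is contradictory and [b] is a placeholder. A Newton step leads to [b - c] with
   [(b - c)^2 = y + c^2 >= y], and some element of [A] lies above [b - c]. *)
exists b; apply/eqP; rewrite eq_le ltW //=; rewrite leNgt; apply/negP => _.
pose c := (b ^+ 2 - y) / (2%:R * b).
have c0 : 0 < c by rewrite divr_gt0 ?subr_gt0 // mulr_gt0.
have cE : c * (2%:R * b) = b ^+ 2 - y by rewrite divfK // mulf_neq0 // gt_eqF.
have cb : c < b by rewrite ltr_pdivrMr ?mulr_gt0 // -subr_gt0; nra.
have [a' [b' [Aa' Bb' cab]]] := normAB _ c0.
have ba' : b - c < a' by have := bmin _ Bb'; lra.
have a'0 : 0 < a' by lra.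
case: Aa' => [|]; first by rewrite leNgt a'0.
have : (b - c) ^+ 2 < a' ^+ 2 by rewrite ltr_sqr ?nnegrE //; lra.
have : 0 <= c ^+ 2 by rewrite sqr_ge0.
by rewrite sqrrB; lra.
Qed.

Section Evaluation.
Variables (L O : realFieldType) (k : {rmorphism L -> O}) (x : O).
Hypothesis k_lt : {homo k : x y / x < y}.

Definition ev (p : {poly L}) : O := (map_poly k p).[x].

Lemma evC c : ev c%:P = k c.
Proof. by rewrite /ev map_polyC hornerC. Qed.
Lemma evX : ev 'X = x.
Proof. by rewrite /ev map_polyX hornerX. Qed.
Lemma evD p q : ev (p + q) = ev p + ev q.
Proof. by rewrite /ev rmorphD hornerD. Qed.
Lemma evB p q : ev (p - q) = ev p - ev q.
Proof. by rewrite /ev rmorphB hornerD hornerN. Qed.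
Lemma evM p q : ev (p * q) = ev p * ev q.
Proof. by rewrite /ev rmorphM hornerM. Qed.
Lemma evXn p n : ev (p ^+ n) = ev p ^+ n.
Proof. by rewrite /ev rmorphXn horner_exp. Qed.

(** A bounded [x] cuts [L]. If the cut is normal it is principal, and its bounding element is
    infinitely close to [x]; otherwise it has a gap. *)
Lemma cut_trichotomy : continuous_closed L ->
  [\/ forall c, k c < `|x|,
      exists a, forall c, 0 < c -> `|x - k a| < k c |
      exists c d, [/\ 0 < c, `|x| <= k d & forall a, k c <= `|x - k a|]].
Proof.
move=> Lcc; have [|/existsNP[d0 /negP]] := pselect (forall c, k c < `|x|).
  by constructor 1.
rewrite -leNgt => xd; pose A := [set a | k a <= x]; pose B := [set a | x < k a].
have cutAB : is_cut A B.
  split; first by rewrite -subTset => a _; have [?|?] := leP (k a) x; [left|right].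
  by move=> a b Aa Bb; rewrite -(monotone_lt k_lt) (le_lt_trans Aa).
have [nAB|/existsNP[c /not_implyP[c0 nc]]] := pselect (normal_cut A B).
  constructor 2.
  have close a' b' c : A a' -> B b' -> b' - a' < c -> k b' - k a' < k c.
    by rewrite -rmorphB (monotone_lt k_lt).
  case: (Lcc _ _ cutAB nAB) => [[a Aa amax]|[b Bb bmin]].
    exists a => c /nAB[a' [b' [Aa' Bb' /(close _ _ _ Aa' Bb') cab]]].
    have := amax _ Aa'; rewrite -(monotone_le k_lt) => a'a.
    by move: Aa Bb'; rewrite /A /B /= ltr_norml => Aa Bb'; apply/andP; split; lra.
  exists b => c /nAB[a' [b' [Aa' Bb' /(close _ _ _ Aa' Bb') cab]]].
  have := bmin _ Bb'; rewrite -(monotone_le k_lt) => bb'.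
  by move: Aa' Bb; rewrite /A /B /= ltr_norml => Aa' Bb; apply/andP; split; lra.
(* Elements of the two halves are at least [c] apart, so with [a] also [a + c / 2] lies in the lower
   half, and symmetrically above. *)
constructor 3; exists (c / 2%:R), d0; split=> //; first by rewrite divr_gt0.
move=> a; have [Aa|Ba] := leP (k a) x.
  rewrite ger0_norm ?subr_ge0 //.
  have [Ac|Bc] := leP (k (a + c / 2%:R)) x; first by move: Ac; rewrite rmorphD /=; lra.
  by case: nc; exists a, (a + c / 2%:R); split=> //; lra.
rewrite ltr0_norm ?subr_lt0 //.
have [Ac|Bc] := leP (k (a - c / 2%:R)) x; last by move: Bc; rewrite rmorphB /=; lra.
by case: nc; exists (a - c / 2%:R), a; split=> //; lra.
Qed.

Lemma ev_bounded d p : `|x| <= k d -> exists2 M, 0 < M & `|ev p| <= k M.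
Proof.
move=> xd; elim/poly_ind: p => [|p c [M M0 IH]].
  by exists 1 => //; rewrite /ev rmorph0 horner0 normr0 rmorph1 ler01.
have d0 : 0 <= d by rewrite -(monotone_le k_lt) rmorph0 (le_trans _ xd).
exists (M * d + `|c| + 1); first by rewrite ltr_wpDl ?ltr01 ?addr_ge0 ?mulr_ge0 // ltW.
rewrite evD evM evX evC 2!rmorphD rmorphM (monotone_norm k_lt) rmorph1 /=.
have h : `|ev p| * `|x| <= k M * k d by apply: ler_pM.
by have := ler_normD (ev p * x) (k c); rewrite normrM; lra.
Qed.

(** [X - a] divides [p - p.[a]], and the cofactor is bounded at [x] by an element of [L]. *)
Lemma ev_near a p e : (forall c, 0 < c -> `|x - k a| < k c) -> 0 < e ->
  `|ev p - k p.[a]| < k e.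
Proof.
move=> xa e0.
have /factor_theorem[s ps] : root (p - (p.[a])%:P) a.
  by rewrite /root !hornerE subrr.
have xd : `|x| <= k (`|a| + 1).
  have := ler_normD (x - k a) (k a); rewrite subrK rmorphD (monotone_norm k_lt) /=.
  by have := xa 1 ltr01; lra.
have [M M0 sM] := ev_bounded s xd.
rewrite -[k p.[a]]evC -evB ps evM evB evX evC normrM.
have := xa _ (divr_gt0 e0 M0); rewrite -(ltr_pM2l (_ : 0 < k M)); last first.
  by rewrite monotone_gt0.
rewrite -rmorphM [M * _]mulrC divfK ?gt_eqF //; apply: le_lt_trans.
by rewrite ler_wpM2r.
Qed.

Definition transcendental := forall p, p != 0 -> ev p != 0.

End Evaluation.

(** The bound [d <= m / 2] keeps [|y'| >= m / 2], so the difference is at most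
    [2 M d / (m^2 / 2)]. *)
Lemma div_close (F : realFieldType) (x y x' y' m M d e : F) :
  0 < m -> m <= `|y| -> `|x| <= M -> `|y| <= M ->
  `|x - x'| <= d -> `|y - y'| <= d -> d <= m / 2%:R -> 4%:R * M * d < e * m ^+ 2 ->
  `|x / y - x' / y'| < e.
Proof.
move=> m0 my xM yM xd yd dm de.
have y'm : m / 2%:R <= `|y'|.
  by have := ler_normD (y - y') y'; rewrite subrK; lra.
have y0 : y != 0 by rewrite -normr_gt0 (lt_le_trans m0).
have y'0 : y' != 0 by rewrite -normr_gt0 (lt_le_trans _ y'm) // divr_gt0.
have -> : x / y - x' / y' = ((x - x') * y - x * (y - y')) / (y * y').
  by field; rewrite y0 y'0.
rewrite normf_div ltr_pdivrMr ?normr_gt0 ?mulf_neq0 //.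
have h1 : `|(x - x') * y - x * (y - y')| <= M * d + M * d.
  apply: le_trans (ler_normB _ _) _; rewrite !normrM lerD //.
    by rewrite mulrC ler_pM.
  by rewrite ler_pM.
have h2 : m * (m / 2%:R) <= `|y * y'| by rewrite normrM ler_pM ?divr_ge0 // ltW.
have e0 : 0 < e.
  have Md : 0 <= 4%:R * M * d.
    by rewrite !mulr_ge0 // (le_trans _ yM, le_trans _ yd).
  by have := le_lt_trans Md de; rewrite pmulr_lgt0 // exprn_gt0.
apply: le_lt_trans h1 _; apply: lt_le_trans (_ : e * (m * (m / 2%:R)) <= _).
  by move: de; rewrite expr2; lra.
by rewrite ler_pM2l.
Qed.

Lemma div_close_modulus (F : realFieldType) (m M e : F) : 0 < m -> 0 < M -> 0 < e ->
  exists d, [/\ 0 < d, d <= m / 2%:R & 4%:R * M * d < e * m ^+ 2].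
Proof.
move=> m0 M0 e0; pose d := Num.min (m / 2%:R) (e * m ^+ 2 / (8%:R * M)).
have em : 0 < e * m ^+ 2 by rewrite mulr_gt0 // exprn_gt0.
exists d; split; first by rewrite lt_min !divr_gt0 ?mulr_gt0.
  by rewrite ge_min lexx.
have : d <= e * m ^+ 2 / (8%:R * M) by rewrite ge_min lexx orbT.
by rewrite ler_pdivlMr ?mulr_gt0 //; lra.
Qed.

(** * Elements infinitely close to a constant *)

Section NearPoint.
Variables (L O : realFieldType) (k : {rmorphism L -> O}) (x : O).
Hypothesis k_lt : {homo k : x y / x < y}.
Variable a : L.
Hypothesis xa : forall c, 0 < c -> `|x - k a| < k c.

Lemma ev_div_near p q e : q.[a] != 0 -> 0 < e ->
  `|ev k x p / ev k x q - k (p.[a] / q.[a])| < k e.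
Proof.
move=> qa e0; pose m := `|q.[a]|; pose M := `|p.[a]| + `|q.[a]|.
have m0 : 0 < m by rewrite normr_gt0.
have M0 : 0 < M by rewrite ltr_wpDl.
have [d [d0 dm de]] := div_close_modulus m0 M0 e0.
rewrite distrC fmorph_div; apply: (@div_close _ _ _ _ _ (k m) (k M) (k d)).
- by rewrite (monotone_gt0 k_lt).
- by rewrite -(monotone_norm k_lt).
- by rewrite -(monotone_norm k_lt) (monotone_le k_lt) lerDl.
- by rewrite -(monotone_norm k_lt) (monotone_le k_lt) lerDr.
- by rewrite distrC ltW // ev_near.
- by rewrite distrC ltW // ev_near.
- by rewrite -(rmorph_nat k 2) -fmorph_div (monotone_le k_lt).
- by rewrite -(rmorph_nat k 4) -rmorphXn -!rmorphM (monotone_lt k_lt).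
Qed.

(** The inverse quotient is infinitely close to its value 0 at [a]. *)
Lemma ev_div_pole p q r : p.[a] != 0 -> q.[a] = 0 ->
  ev k x p != 0 -> ev k x q != 0 -> k r < `|ev k x p / ev k x q|.
Proof.
move=> pa qa p0 q0; have r0 : 0 < `|r| + 1 by rewrite ltr_wpDl.
have rV0 : 0 < (`|r| + 1)^-1 by rewrite invr_gt0.
have := ev_div_near q pa rV0; rewrite qa mul0r rmorph0 subr0 fmorphV /=.
rewrite -[ev k x p / _]invf_div normfV => h.
apply: (@lt_trans _ _ (k (`|r| + 1))).
  by rewrite (monotone_lt k_lt) (le_lt_trans (ler_norm r)) // ltrDl.
by rewrite -ltf_pV2 ?invrK // posrE ?invr_gt0 ?(monotone_gt0 k_lt) // normr_gt0
  mulf_neq0 ?invr_eq0.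
Qed.

End NearPoint.

Section TwoPoints.
Variables (L O1 O2 : realFieldType).
Variables (k1 : {rmorphism L -> O1}) (x1 : O1) (k2 : {rmorphism L -> O2}) (x2 : O2).
Hypotheses (k1_lt : {homo k1 : x y / x < y}) (k2_lt : {homo k2 : x y / x < y}).
Hypotheses (x1_tr : transcendental k1 x1) (x2_tr : transcendental k2 x2).

(** Cancel [X - a] while it divides both [p] and [q]. Then either the quotient is infinitely close
    to its value at [a] for both points, or only [q] vanishes at [a] and the quotient is infinite at
    both. *)
Lemma same_place_near a p q :
  (forall c, 0 < c -> `|x1 - k1 a| < k1 c) ->
  (forall c, 0 < c -> `|x2 - k2 a| < k2 c) -> q != 0 ->
  same_place (ev k1 x1 p / ev k1 x1 q) (ev k2 x2 p / ev k2 x2 q).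
Proof.
move=> xa1 xa2; have [n] := ubnP (size q); elim: n p q => // n IH p q sq q0.
have [qa|qa] := eqVneq q.[a] 0; last first.
  apply: same_place_limit => e e0.
  have eL0 : (0 : L) < ratr e by rewrite ltr0q.
  exists (k1 (p.[a] / q.[a])), (k2 (p.[a] / q.[a])); split.
  - exact: same_place_morph.
  - by rewrite -(fmorph_rat k1); apply: ev_div_near.
  - by rewrite -(fmorph_rat k2); apply: ev_div_near.
have [pa|pa] := eqVneq p.[a] 0; last first.
  have p0 : p != 0 by apply: contra_neq pa => ->; rewrite horner0.
  apply: same_place_infinite => r.
    by rewrite -(fmorph_rat k1); apply: (ev_div_pole k1_lt xa1); rewrite // ?x1_tr.
  by rewrite -(fmorph_rat k2); apply: (ev_div_pole k2_lt xa2); rewrite // ?x2_tr.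
have /factor_theorem[s qs] : root q a by rewrite /root qa.
have /factor_theorem[r pr] : root p a by rewrite /root pa.
have s0 : s != 0 by apply: contra_neq q0 => s0; rewrite qs s0 mul0r.
have d0 : 'X - a%:P != 0 :> {poly L} by rewrite polyXsubC_eq0.
rewrite pr qs !evM -!mulf_div !divff ?mulr1 ?x1_tr ?x2_tr //.
by apply: IH => //; move: sq; rewrite qs size_Mmonic ?monicXsubC // size_XsubC addn2.
Qed.

End TwoPoints.

(** * Infinite elements, by passing to inverses *)

Definition reversal (L : nzRingType) n (p : {poly L}) : {poly L} :=
  \poly_(i < n.+1) p`_(n - i).

Lemma reversalK (L : nzRingType) n (p : {poly L}) :
  (size p <= n.+1)%N -> reversal n (reversal n p) = p.
Proof.
move=> sp; apply/polyP => i; rewrite coef_poly; case: ltnP => hi.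
  by rewrite coef_poly ltnS leq_subr subKn.
by rewrite nth_default // (leq_trans sp).
Qed.

Lemma reversal0 (L : nzRingType) n : reversal n 0 = 0 :> {poly L}.
Proof. by apply/polyP => i; rewrite coef_poly !coef0 if_same. Qed.

Section Reversal.
Variables (L O : realFieldType) (k : {rmorphism L -> O}) (x : O).
Hypothesis x0 : x != 0.

(** [reversal n p] is [X^n p(1/X)]; leaving [n] free lets numerator and denominator share it. *)
Lemma ev_reversal n (p : {poly L}) : (size p <= n.+1)%N ->
  ev k x p = x ^+ n * ev k x^-1 (reversal n p).
Proof.
move=> sp; rewrite /ev (@horner_coef_wide _ n.+1) ?size_map_poly //.
rewrite (@horner_coef_wide _ n.+1 (map_poly k _)) ?size_map_poly ?size_poly //.
rewrite mulr_sumr (reindex_inj rev_ord_inj) /=; apply: eq_bigr => i _.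
rewrite !coef_map coef_poly /= ltn_ord subSS mulrCA exprVn; congr (_ * _).
by rewrite exprB ?unitfE // -ltnS.
Qed.

Lemma transcendentalV : transcendental k x -> transcendental k x^-1.
Proof.
move=> tr r r0; have sr : (size r <= (size r).-1.+1)%N by rewrite leqSpred.
have s1 : (size (reversal (size r).-1 r) <= (size r).-1.+1)%N by exact: size_poly.
have := tr (reversal (size r).-1 r); rewrite (ev_reversal s1) reversalK //.
rewrite mulf_eq0 negb_or => h.
have /h/andP[//] : reversal (size r).-1 r != 0.
by apply: contra_neq r0 => r0; rewrite -(reversalK sr) r0 reversal0.
Qed.

(* This reduces X infinite to 1/X infinitely close to 0. *)
Lemma ev_div_reversal n (p q : {poly L}) : (size p <= n.+1)%N -> (size q <= n.+1)%N ->
  ev k x p / ev k x q = ev k x^-1 (reversal n p) / ev k x^-1 (reversal n q).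
Proof.
move=> sp sq; rewrite !(@ev_reversal n) //.
by rewrite -mulf_div divff ?mul1r // expf_neq0.
Qed.

End Reversal.

Section TwoInfinitePoints.
Variables (L O1 O2 : realFieldType).
Variables (k1 : {rmorphism L -> O1}) (x1 : O1) (k2 : {rmorphism L -> O2}) (x2 : O2).
Hypotheses (k1_lt : {homo k1 : x y / x < y}) (k2_lt : {homo k2 : x y / x < y}).
Hypotheses (x1_tr : transcendental k1 x1) (x2_tr : transcendental k2 x2).

Lemma same_place_infinity p q :
  (forall c, k1 c < `|x1|) -> (forall c, k2 c < `|x2|) -> q != 0 ->
  same_place (ev k1 x1 p / ev k1 x1 q) (ev k2 x2 p / ev k2 x2 q).
Proof.
move=> h1 h2 q0.
have n1 : x1 != 0 by rewrite -normr_gt0 -(rmorph0 k1).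
have n2 : x2 != 0 by rewrite -normr_gt0 -(rmorph0 k2).
pose n := maxn (size p) (size q).
have sp : (size p <= n.+1)%N by rewrite leqW // leq_maxl.
have sq : (size q <= n.+1)%N by rewrite leqW // leq_maxr.
rewrite (ev_div_reversal k1 n1 sp sq) (ev_div_reversal k2 n2 sp sq).
have inv_small (O : realFieldType) (k : {rmorphism L -> O}) (x : O) :
    {homo k : x y / x < y} -> (forall c, k c < `|x|) -> x != 0 ->
    forall c, 0 < c -> `|x^-1 - k 0| < k c.
  move=> k_lt h x0 c c0; rewrite rmorph0 subr0 normfV.
  rewrite -[k c]invrK ltf_pV2 ?posrE ?normr_gt0 ?invr_gt0 ?(monotone_gt0 k_lt) //.
  by rewrite -fmorphV.
apply: (@same_place_near _ _ _ _ _ _ _ _ _ _ _ 0) => //.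
- exact: transcendentalV.
- exact: transcendentalV.
- exact: inv_small.
- exact: inv_small.
- by apply: contra_neq q0 => q0; rewrite -(reversalK sq) q0 reversal0.
Qed.

End TwoInfinitePoints.

(** * Places of L(X) are determined on a dense subfield *)

Section DenseSubfield.
Variables (R : rcfType) (L : realFieldType) (i : {rmorphism R -> L}).
Hypothesis i_dense : forall x y : L, x < y -> exists z : R, x < i z < y.

Lemma dense_near (a e : L) : 0 < e -> exists z, `|a - i z| < e.
Proof.
move=> e0; have /i_dense[z /andP[h1 h2]] : a - e < a + e by lra.
by exists z; rewrite ltr_norml; apply/andP; split; lra.
Qed.

(** Over [R] each linear factor is at least [c] in absolute value by hypothesis, and each quadratic
    factor at least [c^2]. *)
Lemma ev_lower_bound (O : realFieldType) (k : {rmorphism L -> O}) (x : O) c p :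
  {homo k : x y / x < y} -> 0 < c -> (forall a, k c <= `|x - k a|) -> p != 0 ->
  k (`|i (lead_coef p)| * c ^+ (size p).-1) <= `|ev k x (map_poly i p)|.
Proof.
move=> k_lt c0 xc; have kc0 : 0 < k c by rewrite (monotone_gt0 k_lt).
elim/rcf_poly_ind: p => [a|p q IHp IHq|a|b a a0].
- rewrite polyC_eq0 => a0; rewrite lead_coefC size_polyC a0 /= mulr1.
  by rewrite map_polyC evC (monotone_norm k_lt).
- rewrite mulf_eq0 negb_or => /andP[p0 q0].
  rewrite lead_coefM [i _]rmorphM [map_poly i _]rmorphM /= evM !normrM size_mul //.
  have -> : ((size p + size q).-1.-1 = (size p).-1 + (size q).-1)%N.
    rewrite -!size_poly_gt0 in p0 q0.
    by case: (size p) p0 => // a _; case: (size q) q0 => // b _; rewrite addSn addnS.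
  rewrite exprD mulrACA rmorphM ler_pM ?IHp ?IHq //.
    by rewrite -(rmorph0 k) (monotone_le k_lt) mulr_ge0 // exprn_ge0 // ltW.
  by rewrite -(rmorph0 k) (monotone_le k_lt) mulr_ge0 // exprn_ge0 // ltW.
- by move=> _; rewrite lead_coefXsubC size_XsubC rmorph1 normr1 mul1r map_polyXsubC
    evB evX evC.
- move=> _; have s2 : (size (a ^+ 2)%:P < size (('X - b%:P) ^+ 2))%N.
    by rewrite size_exp_XsubC size_polyC; case: (_ != 0).
  rewrite lead_coefDl // size_polyDl // size_exp_XsubC.
  rewrite (monicP (monic_exp _ (monicXsubC b))) rmorph1 normr1 mul1r /=.
  rewrite rmorphD !rmorphXn /= map_polyXsubC map_polyC evD !evXn evB evX !evC /=.
  rewrite ger0_norm ?addr_ge0 ?sqr_ge0 //.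
  rewrite -[(x - _) ^+ 2]real_normK ?num_real //.
  have h := xc (i b).
  have : k c ^+ 2 <= `|x - k (i b)| ^+ 2 by rewrite ler_sqr ?nnegrE // ltW.
  move/le_trans; apply; rewrite lerDl; exact: sqr_ge0.
Qed.

(* The approximation depends neither on O nor on x, so that one element of R(X)
   serves two orders at once. *)
Lemma ev_approx (D : L) n (p : {poly L}) e : 0 < D -> 0 < e -> (size p <= n)%N ->
  exists2 p' : {poly R}, (size p' <= n)%N &
    forall (O : realFieldType) (k : {rmorphism L -> O}) (x : O),
      {homo k : x y / x < y} -> `|x| <= k D ->
      `|ev k x p - ev k x (map_poly i p')| < k e.
Proof.
move=> D0; elim/poly_ind: p n e => [|p c IH] [|n] e e0.
- exists 0; first by rewrite size_poly0.
  by move=> O k x k_lt _; rewrite rmorph0 subrr normr0 (monotone_gt0 k_lt).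
- exists 0; first by rewrite size_poly0.
  by move=> O k x k_lt _; rewrite rmorph0 subrr normr0 (monotone_gt0 k_lt).
- rewrite leqn0 size_poly_eq0 => /eqP ->; exists 0; first by rewrite size_poly0.
  by move=> O k x k_lt _; rewrite rmorph0 subrr normr0 (monotone_gt0 k_lt).
rewrite size_MXaddC => sp.
have {}sp : (size p <= n)%N by move: sp; case: eqP => [->|//]; rewrite size_poly0.
have e2 : 0 < e / 2%:R by rewrite divr_gt0.
(* The error of [p'] gets multiplied by [|x| <= D], hence the division by [D]; the other half of [e]
   is for the constant coefficient. *)
have [p' sp' hp'] := IH n _ (divr_gt0 e2 D0) sp.
have [c' hc'] := dense_near c e2.
exists (p' * 'X + c'%:P).
  by rewrite size_MXaddC; case: ifP => // _; rewrite ltnS.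
move=> O k x k_lt xD; rewrite rmorphD rmorphM /= map_polyX map_polyC /= !evD !evM !evX !evC.
have -> : ev k x p * x + k c - (ev k x (map_poly i p') * x + k (i c')) =
  (ev k x p - ev k x (map_poly i p')) * x + (k c - k (i c')) by ring.
apply: le_lt_trans (ler_normD _ _) _; rewrite normrM.
have h1 : `|ev k x p - ev k x (map_poly i p')| * `|x| <= k (e / 2%:R / D) * k D.
  by apply: ler_pM => //; apply/ltW/hp'.
move: h1; rewrite -rmorphM divfK ?gt_eqF // => h1.
have : `|k c - k (i c')| < k (e / 2%:R).
  by rewrite -rmorphB -(monotone_norm k_lt) (monotone_lt k_lt).
have -> : k e = k (e / 2%:R) + k (e / 2%:R) by rewrite -rmorphD; congr (k _); lra.
lra.
Qed.

(** After division by [l] only the lower coefficients are approximated. The approximation over [R]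
    is thus monic of degree [n] and bounded below by [c^n] however it is chosen; an error below
    [c^n / 2] leaves half of that. *)
Lemma ev_away_from0 (c D : L) (p : {poly L}) : 0 < c -> 0 < D -> p != 0 ->
  exists2 m, 0 < m & forall (O : realFieldType) (k : {rmorphism L -> O}) (x : O),
    {homo k : x y / x < y} -> `|x| <= k D -> (forall a, k c <= `|x - k a|) ->
    k m <= `|ev k x p|.
Proof.
move=> c0 D0 p0; pose n := (size p).-1; pose l := lead_coef p.
have l0 : l != 0 by rewrite lead_coef_eq0.
have sp : size p = n.+1 by rewrite prednK // size_poly_gt0.
pose r := l^-1 *: p - 'X^n.
have pE : p = l%:P * ('X^n + r) by rewrite /r addrC subrK mul_polyC scalerA divff // scale1r.
have sr : (size r <= n)%N.
  apply/leq_sizeP => j; rewrite leq_eqVlt coefB coefZ coefXn => /orP[/eqP <-|nj].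
    by rewrite eqxx mulVf // subrr.
  by rewrite nth_default ?sp // mulr0 gtn_eqF // subrr.
have cn : 0 < c ^+ n by rewrite exprn_gt0.
have cn2 : 0 < c ^+ n / 2%:R by rewrite divr_gt0.
have [r' sr' hr'] := ev_approx D0 cn2 sr.
exists (`|l| * (c ^+ n / 2%:R)); first by rewrite mulr_gt0 ?normr_gt0.
move=> O k x k_lt xD xc.
have sX : (size r' < size ('X^n : {poly R}))%N by rewrite size_polyXn.
have lX : lead_coef ('X^n + r') = 1 by rewrite lead_coefDl // lead_coefXn.
have X0 : 'X^n + r' != 0 by rewrite -lead_coef_eq0 lX oner_eq0.
have := ev_lower_bound k_lt c0 xc X0.
rewrite lX rmorph1 normr1 mul1r size_polyDl // size_polyXn /=.
rewrite rmorphD /= map_polyXn evD evXn evX => h.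
rewrite pE evM evC evD evXn evX normrM rmorphM (monotone_norm k_lt) ler_wpM2l //.
have := hr' O k x k_lt xD.
have := ler_normD (x ^+ n + ev k x r) (ev k x (map_poly i r') - ev k x r).
rewrite [X in `|X| <= _](_ : _ = x ^+ n + ev k x (map_poly i r')); last by ring.
rewrite distrC => h2.
have : k (c ^+ n) = k (c ^+ n / 2%:R) + k (c ^+ n / 2%:R).
  by rewrite -rmorphD; congr (k _); lra.
lra.
Qed.

(** * Two elements whose places agree over R *)

Section TwoPlaces.
Variables O1 O2 : realFieldType.
Variables (k1 : {rmorphism L -> O1}) (x1 : O1) (k2 : {rmorphism L -> O2}) (x2 : O2).
Hypotheses (k1_lt : {homo k1 : x y / x < y}) (k2_lt : {homo k2 : x y / x < y}).
Hypothesis same_R : forall p q : {poly R},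
  same_place (ev k1 x1 (map_poly i p) / ev k1 x1 (map_poly i q))
             (ev k2 x2 (map_poly i p) / ev k2 x2 (map_poly i q)).

(** Since [q] stays away from zero, close approximations of [p] and [q] over [R] give a quotient
    close to [p / q] at both points, and [same_R] applies to it. *)
Lemma same_place_separated c1 D1 c2 D2 p q :
  0 < c1 -> `|x1| <= k1 D1 -> (forall a, k1 c1 <= `|x1 - k1 a|) ->
  0 < c2 -> `|x2| <= k2 D2 -> (forall a, k2 c2 <= `|x2 - k2 a|) -> q != 0 ->
  same_place (ev k1 x1 p / ev k1 x1 q) (ev k2 x2 p / ev k2 x2 q).
Proof.
move=> c10 x1D x1c c20 x2D x2c q0.
pose c := Num.min c1 c2; pose D := Num.max 1 (Num.max D1 D2).
have c0 : 0 < c by rewrite lt_min c10.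
have D0 : 0 < D by rewrite lt_max ltr01.
have {}x1D : `|x1| <= k1 D.
  by apply: le_trans x1D _; rewrite (monotone_le k1_lt) !le_max lexx !orbT.
have {}x2D : `|x2| <= k2 D.
  by apply: le_trans x2D _; rewrite (monotone_le k2_lt) !le_max lexx !orbT.
have {}x1c a : k1 c <= `|x1 - k1 a|.
  by apply: le_trans (x1c a); rewrite (monotone_le k1_lt) ge_min lexx.
have {}x2c a : k2 c <= `|x2 - k2 a|.
  by apply: le_trans (x2c a); rewrite (monotone_le k2_lt) ge_min lexx orbT.
have [m m0 hm] := ev_away_from0 c0 D0 q0.
have [P1 P10 hP1] := ev_bounded k1_lt p x1D.
have [Q1 Q10 hQ1] := ev_bounded k1_lt q x1D.
have [P2 P20 hP2] := ev_bounded k2_lt p x2D.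
have [Q2 Q20 hQ2] := ev_bounded k2_lt q x2D.
pose M := (P1 + Q1) + (P2 + Q2).
have M0 : 0 < M by rewrite !addr_gt0.
apply: same_place_limit => e e0.
have eL0 : (0 : L) < ratr e by rewrite ltr0q.
have [d [d0 dm de]] := div_close_modulus m0 M0 eL0.
have [p' _ hp'] := ev_approx D0 d0 (leqnn (size p)).
have [q' _ hq'] := ev_approx D0 d0 (leqnn (size q)).
exists (ev k1 x1 (map_poly i p') / ev k1 x1 (map_poly i q')).
exists (ev k2 x2 (map_poly i p') / ev k2 x2 (map_poly i q')).
have key (O : realFieldType) (k : {rmorphism L -> O}) (x : O) :
    {homo k : x y / x < y} -> `|x| <= k D -> (forall a, k c <= `|x - k a|) ->
    `|ev k x p| <= k M -> `|ev k x q| <= k M ->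
    `|ev k x p / ev k x q - ev k x (map_poly i p') / ev k x (map_poly i q')| < ratr e.
  move=> k_lt xD xc pM qM; rewrite -(fmorph_rat k).
  apply: (@div_close _ _ _ _ _ (k m) (k M) (k d)) => //.
  - by rewrite (monotone_gt0 k_lt).
  - exact: hm.
  - by apply/ltW/hp'.
  - by apply/ltW/hq'.
  - by rewrite -(rmorph_nat k 2) -fmorph_div (monotone_le k_lt).
  - by rewrite -(rmorph_nat k 4) -rmorphXn -!rmorphM (monotone_lt k_lt).
split=> //; apply: key => //.
- by apply: le_trans hP1 _; rewrite (monotone_le k1_lt) /M; lra.
- by apply: le_trans hQ1 _; rewrite (monotone_le k1_lt) /M; lra.
- by apply: le_trans hP2 _; rewrite (monotone_le k2_lt) /M; lra.
- by apply: le_trans hQ2 _; rewrite (monotone_le k2_lt) /M; lra.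
Qed.

(** The test element [(X - a') / c'] over [R] is below [1/2] in absolute value at the first point,
    hence below 1 at the second. *)
Lemma near_transfer a : (forall c, 0 < c -> `|x1 - k1 a| < k1 c) ->
  forall c, 0 < c -> `|x2 - k2 a| < k2 c.
Proof.
move=> xa c c0; have /i_dense[c' /andP[c'0 c'c]] : 0 < c / 2%:R by rewrite divr_gt0.
(* This yields [|x1 - a'| < c' / 2] and in the end [|x2 - a| < c' + c' / 4 < c]. *)
have c'4 : 0 < i c' / 4%:R by rewrite divr_gt0.
have [a' aa'] := dense_near a c'4.
have ev_quot (O : realFieldType) (k : {rmorphism L -> O}) (x : O) :
    ev k x (map_poly i ('X - a'%:P)) / ev k x (map_poly i c'%:P) =
    (x - k (i a')) / k (i c').
  by rewrite map_polyXsubC map_polyC evB evX !evC.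
have kc0 (O : realFieldType) (k : {rmorphism L -> O}) :
    {homo k : x y / x < y} -> 0 < k (i c').
  by move=> k_lt; rewrite (monotone_gt0 k_lt).
have kaa (O : realFieldType) (k : {rmorphism L -> O}) :
    {homo k : x y / x < y} -> `|k a - k (i a')| < k (i c') / 4%:R.
  move=> k_lt; rewrite -rmorphB -(monotone_norm k_lt).
  by rewrite -(rmorph_nat k 4) -fmorph_div (monotone_lt k_lt).
have h12 : (2%:R^-1 : rat) < 1 by [].
have [+ _] := same_R ('X - a'%:P) c'%:P 0 h12.
rewrite !ev_quot !rmorph0 !subr0 rmorph1 fmorphV rmorph_nat.
rewrite !normf_div !(gtr0_norm (kc0 _ _ _)) // !ltr_pdivrMr ?kc0 // mul1r => h.
have {}h : `|x2 - k2 (i a')| < k2 (i c').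
  apply: h; have := xa _ c'4; have := kaa _ _ k1_lt.
  rewrite fmorph_div rmorph_nat; have := ler_normD (x1 - k1 a) (k1 a - k1 (i a')).
  by rewrite addrA subrK; lra.
have := ler_normD (x2 - k2 (i a')) (k2 (i a') - k2 a); rewrite addrA subrK.
rewrite (distrC (k2 (i a'))).
have := kaa _ _ k2_lt; have := kc0 _ _ k2_lt.
have : k2 (i c') < k2 (c / 2%:R) by rewrite (monotone_lt k2_lt).
by rewrite fmorph_div rmorph_nat; lra.
Qed.

(** If [|x2| < d] for some [d] of [R] above [|c|], then [X / d] is below 1 in absolute value at the
    second point, hence below 2 at the first, where it is infinite. *)
Lemma infinite_transfer : (forall c, k1 c < `|x1|) -> forall c, k2 c < `|x2|.
Proof.
move=> xinf c; have /i_dense[d /andP[cd _]] : `|c| < `|c| + 1 by rewrite ltrDl.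
have kd0 (O : realFieldType) (k : {rmorphism L -> O}) :
    {homo k : x y / x < y} -> 0 < k (i d).
  by move=> k_lt; rewrite (monotone_gt0 k_lt) (le_lt_trans _ cd).
have h12 : (1 : rat) < 2%:R by [].
have [_ +] := same_R 'X d%:P 0 h12.
rewrite !map_polyX !map_polyC !evX !evC /= !rmorph0 !subr0 rmorph1 rmorph_nat.
rewrite !normf_div !(gtr0_norm (kd0 _ _ _)) // !ltr_pdivrMr ?kd0 // mul1r => h.
have := xinf (2%:R * i d); rewrite rmorphM rmorph_nat ltNge => /negP hn.
have : k2 (i d) <= `|x2|.
  by rewrite leNgt; apply/negP => /h /ltW.
by apply: lt_le_trans; rewrite (monotone_lt k2_lt) (le_lt_trans (ler_norm c)).
Qed.

End TwoPlaces.

(** If one point is infinite or infinitely close to some [a], then so is the other, with the same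
    [a]. In the remaining case both are separated from [L]. *)
Lemma same_place_extend (O1 O2 : realFieldType)
    (k1 : {rmorphism L -> O1}) (x1 : O1) (k2 : {rmorphism L -> O2}) (x2 : O2) p q :
  continuous_closed L ->
  {homo k1 : x y / x < y} -> {homo k2 : x y / x < y} ->
  transcendental k1 x1 -> transcendental k2 x2 ->
  (forall p q : {poly R},
    same_place (ev k1 x1 (map_poly i p) / ev k1 x1 (map_poly i q))
               (ev k2 x2 (map_poly i p) / ev k2 x2 (map_poly i q))) ->
  q != 0 -> same_place (ev k1 x1 p / ev k1 x1 q) (ev k2 x2 p / ev k2 x2 q).
Proof.
move=> Lcc k1_lt k2_lt tr1 tr2 same_R q0.
have same_R' r s := same_place_sym (same_R r s).
have [inf1|[a near1]|[c1 [D1 [c10 x1D x1c]]]] := cut_trichotomy x1 k1_lt Lcc.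
- apply: same_place_infinity => //; exact: (infinite_transfer k1_lt k2_lt same_R inf1).
- apply: (@same_place_near _ _ _ k1 x1 k2 x2 _ _ _ _ a) => //.
  exact: (near_transfer k1_lt k2_lt same_R near1).
have [inf2|[a near2]|[c2 [D2 [c20 x2D x2c]]]] := cut_trichotomy x2 k2_lt Lcc.
- apply: same_place_infinity => //; exact: (infinite_transfer k2_lt k1_lt same_R' inf2).
- apply: (@same_place_near _ _ _ k1 x1 k2 x2 _ _ _ _ a) => //.
  exact: (near_transfer k2_lt k1_lt same_R' near2).
exact: (same_place_separated k1_lt k2_lt same_R _ c10 x1D x1c c20 x2D x2c).
Qed.

End DenseSubfield.

(** * Orders of L(X) as evaluations at X, and the homeomorphism *)

Section OrderOfRationalFunctions.
Variables (L : realFieldType) (P : field_order {fraction {poly L}}).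
Hypothesis L_sqrt : forall y : L, 0 < y -> exists x, y = x ^+ 2.

Let T : {rmorphism {poly L} -> ordered P} := @tofrac {poly L}.

Definition const_morph : {rmorphism L -> ordered P} := T \o polyC.

Lemma const_morph_lt : {homo const_morph : x y / x < y}.
Proof.
move=> x y; rewrite -subr_gt0 => xy; rewrite -subr_gt0 -rmorphB.
have [z zE] := L_sqrt xy.
rewrite lt_neqAle eq_sym fmorph_eq0 gt_eqF // andTb zE.
by rewrite (rmorphXn const_morph) sqr_ge0.
Qed.

Lemma ev_tofrac p : ev const_morph (T 'X) p = tofrac p.
Proof.
rewrite -[RHS]/(T p) /ev; elim/poly_ind: p => [|p c IH].
  by rewrite !rmorph0 horner0.
by rewrite !rmorphD !rmorphM /= map_polyX map_polyC hornerMXaddC IH.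
Qed.

Lemma transcendental_X : transcendental const_morph (T 'X).
Proof. by move=> p p0; rewrite ev_tofrac tofrac_eq0. Qed.

End OrderOfRationalFunctions.

(** In either order an element of [L(X)] is a quotient of evaluations at [X], and equality of the
    restricted places is [same_place] for the quotients over [R]. *)
Lemma restrict_place_inj (RR : realType) (R : rcfType) (L : realFieldType)
    (i : {rmorphism R -> L}) (j : {rmorphism {fraction {poly R}} -> {fraction {poly L}}}) :
  continuous_closure i -> (forall p, j (tofrac p) = tofrac (map_poly i p)) ->
  injective (@restrict_place RR _ _ j).
Proof.
move=> ccl jE p1 p2; have [_ Lcc dense] := ccl.
have L_sqrt y : 0 < y -> exists x, y = x ^+ 2 := @continuous_closed_sqrt R L i y ccl.
have [P1 <-] := place_of_order_surj p1; have [P2 <-] := place_of_order_surj p2.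
move=> e; apply: place_eq => f /=; apply/real_place_same.
have [[p q] /= q0 ->] := fraction_split f.
have := @same_place_extend R L i dense _ _ _ _ _ _ p q Lcc
  (const_morph_lt P1 L_sqrt) (const_morph_lt P2 L_sqrt)
  (@transcendental_X L P1) (@transcendental_X L P2).
rewrite !ev_tofrac; apply=> // r s; rewrite !ev_tofrac.
apply/(real_place_same RR).
have := congr1 (fun m : place_space RR _ => place_fun m (tofrac r / tofrac s)) e.
by rewrite /= fmorph_div !jE.
Qed.

Theorem theorem2p9 (RR : realType) (R : rcfType) (Rt : realFieldType)
    (iota : {rmorphism R -> Rt}) :
  continuous_closure iota ->
  homeomorphic (place_space RR {fraction {poly R}})
               (place_space RR {fraction {poly Rt}}).
Proof.
move=> ccl; have [iota_lt _ _] := ccl.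
pose h : {rmorphism {poly R} -> {fraction {poly Rt}}} :=
  @tofrac {poly Rt} \o map_poly iota.
have h_inj : injective h.
  by move=> p q /eqP; rewrite tofrac_eq => /eqP/map_poly_inj.
have [j jE] := frac_lift_exists h_inj.
apply/homeomorphic_sym/(compact_hausdorff_homeomorphic (f := @restrict_place RR _ _ j)).
- exact: place_space_compact.
- exact: place_space_hausdorff.
- exact: restrict_place_continuous.
- exact: (restrict_place_inj ccl).
move=> p; have [P <-] := place_of_order_surj p.
have [Q QP] := restrict_order_surj iota_lt jE P.
by exists (place_of_order RR Q); rewrite restrict_place_of_order QP.
Qed.
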